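(* Let the family of two-person zero-sum games $\{\{A(x),B(x),c(x,\cdot,\cdot)\}:x\in\mathbb{X}\}$ satisfy the following two assumptions: the function $c^{\mathbb{A}\leftrightarrow\mathbb{B}}:\mathrm{Gr}(\tilde A)\to\mathbb{R}$, $c^{\mathbb{A}\leftrightarrow\mathbb{B}}(x,b,a)=c(x,a,b)$, is $\mathbb{K}$-inf-compact on $\mathrm{Gr}(\tilde A)$; and the set-valued mapping $B:\mathbb{X}\to S(\mathbb{B})$ is lower semi-continuous. Then: (i) for each $x\in\mathbb{X}$ $$\sup_{\pi^{\mathbb B}\in\mathbb{P}^S(B(x))}\hat c^\flat(x,\pi^{\mathbb B})=\inf_{\pi^{\mathbb A}\in\mathbb{P}(A(x))}\hat c^\sharp(x,\pi^{\mathbb A})=:v(x),$$ and $v:\mathbb{X}\to\mathbb{R}$ is a (real-valued) lower semi-continuous function; (ii) the sets $\mathbb{P}^\sharp_{v(x)}(A(x))=\{\pi^{\mathbb A}\in\mathbb{P}(A(x)):\hat c^\sharp(x,\pi^{\mathbb A})\le v(x)\}$, $x\in\mathbb{X}$, satisfy: (a) for each $x\in\mathbb{X}$ the set $\mathbb{P}^\sharp_{v(x)}(A(x))$ is a nonempty convex compact subset of $\mathbb{P}(\mathbb{A})$; (b) the graph $\{(x,\pi^{\mathbb A}):x\in\mathbb{X},\ \pi^{\mathbb A}\in\mathbb{P}^\sharp_{v(x)}(A(x))\}$ is a Borel subset of $\mathbb{X}\times\mathbb{P}(\mathbb{A})$; (c) there exists a measurable mapping $\phi^{\mathbb A}:\mathbb{X}\to\mathbb{P}(\mathbb{A})$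 such that $\phi^{\mathbb A}(x)\in\mathbb{P}^\sharp_{v(x)}(A(x))$ for each $x\in\mathbb{X}$.
   Context: $\mathbb{X},\mathbb{A},\mathbb{B}$ are Borel subsets of Polish spaces; $K_{\mathbb A}\subset\mathbb{X}\times\mathbb{A}$ and $K_{\mathbb B}\subset\mathbb{X}\times\mathbb{B}$ are Borel sets such that for each $x\in\mathbb{X}$ the sections $A(x)=\{a:(x,a)\in K_{\mathbb A}\}$ and $B(x)=\{b:(x,b)\in K_{\mathbb B}\}$ are nonempty. $\mathcal{K}=\{(x,a,b):x\in\mathbb{X},a\in A(x),b\in B(x)\}$ and $c:\mathcal{K}\to\mathbb{R}$. Let $\tilde A(x,b)=A(x)$ for $(x,b)\in K_{\mathbb B}$, so $\mathrm{Gr}(\tilde A)=\{(x,b,a):(x,a,b)\in\mathcal{K}\}$. $S(E)$ is the family of nonempty subsets of $E$. That $\{A(x),B(x),c(x,\cdot,\cdot)\}$ is a two-person zero-sum game means: $c(x,\cdot,\cdot)$ is a real-valued Borel measurable function on $A(x)\times B(x)$, for each $b\in B(x)$ the function $a\mapsto c(x,a,b)$ is bounded from below on $A(x)$, and for each $a\in A(x)$ the function $b\mapsto c(x,a,b)$ is bounded from above on $B(x)$. $\mathbb{K}$-inf-compactness: $c^{\mathbb{A}\leftrightarrow\mathbb{B}}$ is $\mathbb{K}$-inf-compact on $\mathrm{Gr}(\tilde A)$ if for every nonempty compact $C\subset K_{\mathbb B}$ and every $\lambda\in\mathbb{R}$ the set $\{(x,b,a):(x,b)\in C,\ a\in A(x),\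 c(x,a,b)\le\lambda\}$ is compact. Lower semi-continuity of $B$ is in the usual (Berge) sense. $\mathbb{P}(E)$ is the set of Borel probability measures on $E$ with the topology of weak convergence; $\mathbb{P}(A(x))$ is identified with the set of measures in $\mathbb{P}(\mathbb{A})$ concentrated on $A(x)$. For fixed $x$, with $c^+=\max\{c,0\}$, $c^-=\min\{c,0\}$, set $\hat c(x,\pi^{\mathbb A},\pi^{\mathbb B})=\int_{A(x)}\int_{B(x)}c^+(x,a,b)\pi^{\mathbb B}(db)\pi^{\mathbb A}(da)+\int_{A(x)}\int_{B(x)}c^-(x,a,b)\pi^{\mathbb B}(db)\pi^{\mathbb A}(da)$, well-defined when at least one of the two terms is finite. A point as an argument of $\hat c$ stands for the measure concentrated at that point. $\mathbb{P}^S(B(x))$ is the set of $\pi^{\mathbb B}\in\mathbb{P}(B(x))$ such that $\hat c(x,\pi^{\mathbb A},\pi^{\mathbb B})$ is well-defined for all $\pi^{\mathbb A}\in\mathbb{P}(A(x))$. Finally $\hat c^\sharp(x,\pi^{\mathbb A})=\sup_{b\in B(x)}\hat c(x,\pi^{\mathbb A},b)$ and $\hat c^\flat(x,\pi^{\mathbb B})=\inf_{a\in A(x)}\hat c(x,a,\pi^{\mathbb B})$. *)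

(* Defs.v *)
From HB Require Import structures.
From mathcomp Require Import all_boot all_order all_algebra.
From mathcomp Require Import all_classical all_reals all_analysis.

Set Implicit Arguments.
Unset Strict Implicit.
Unset Printing Implicit Defensive.

Import Order.TTheory GRing.Theory Num.Theory.
Import numFieldNormedType.Exports.

Local Open Scope classical_set_scope.
Local Open Scope ring_scope.

(* A Hausdorff pseudometric space is a metric space. *)
Definition polish (R : realType) (T : completePseudoMetricType R) : Prop :=
  hausdorff_space T /\ exists2 D : set T, countable D & dense D.

(* [borel] and [borel_fun] serve on spaces that may be empty; [measurable] and
   [measurable_fun] require pointed types. *)
Definition borel (T : topologicalType) (S : set T) : Prop := <<s @open T >> S.

Definition borel_fun (S T : topologicalType) (f : S -> T) : Prop :=
  forall U : set T, borel U -> borel (f @^-1` U).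

Notation borelType T := (g_sigma_algebraType (@open T)).

Section probability_measures.
Context {R : realType} {T : ptopologicalType}.
Implicit Types E : set T.

(* For Borel E, Borel probability measures on E are identified with Borel
   probability measures on the ambient space concentrated on E. *)
Definition concentrated E : set (probability (borelType T) R) :=
  [set mu | mu E = 1%E].

(* Only the values on E of a test function matter. *)
Definition bounded_continuous E : set (T -> R) :=
  [set f | {within E, continuous f} /\
           exists M : R, forall t, E t -> `|f t| <= M].

(* P(E) with the topology of weak convergence: the coarsest topology making
   mu |-> \int_E f dmu continuous for every bounded continuous f on E.
   Elements of [probability] that agree on the Borel sets but differ on other
   sets are topologically indistinguishable here. *)
Definition weakP E : topologicalType :=
  initial_topology (fun mu : concentrated E =>
    (fun f : bounded_continuous E =>
       \int[\val mu]_(t in E) (\val f) t) : {ptws bounded_continuous E -> R}).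

Definition weakP_val E (mu : weakP E) : probability (borelType T) R := \val mu.

(* The mixture is pinned down on the Borel sets only, see [weakP]. *)
Definition convex_weakP E (S : set (weakP E)) : Prop :=
  forall (t : R) (mu nu rho : weakP E), 0 <= t <= 1 -> S mu -> S nu ->
    (forall U : set T, borel U ->
       weakP_val rho U =
       t%:E * weakP_val mu U + (1 - t)%:E * weakP_val nu U)%E ->
    S rho.

End probability_measures.

Arguments concentrated R {T} E.
Arguments weakP R {T} E.

Section game.
Context {R : realType} {TA TB : ptopologicalType}.
Variables (Ax : set TA) (Bx : set TB) (g : TA -> TB -> R).

Definition zero_sum_game : Prop :=
  [/\ measurable_fun (Ax `*` Bx : set (borelType (TA * TB)%type))
        (fun ab => g ab.1 ab.2),
      forall b, Bx b -> has_lbound [set g a b | a in Ax] &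
      forall a, Ax a -> has_ubound [set g a b | b in Bx]].

Local Notation PA := (probability (borelType TA) R).
Local Notation PB := (probability (borelType TB) R).
Local Open Scope ereal_scope.

Definition payoff_pos (piA : PA) (piB : PB) : \bar R :=
  \int[piA]_(a in Ax) \int[piB]_(b in Bx) (Num.max (g a b) 0%R)%:E.

Definition payoff_neg (piA : PA) (piB : PB) : \bar R :=
  \int[piA]_(a in Ax) \int[piB]_(b in Bx) (Num.min (g a b) 0%R)%:E.

Definition payoff_defined (piA : PA) (piB : PB) : Prop :=
  payoff_pos piA piB \is a fin_num \/ payoff_neg piA piB \is a fin_num.

(* Meaningful only under [payoff_defined]; otherwise this is +oo - oo. *)
Definition payoff (piA : PA) (piB : PB) : \bar R :=
  payoff_pos piA piB + payoff_neg piA piB.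

Definition payoff_sharp (piA : PA) : \bar R :=
  ereal_sup [set payoff piA \d_(b : borelType TB) | b in Bx].

Definition payoff_flat (piB : PB) : \bar R :=
  ereal_inf [set payoff \d_(a : borelType TA) piB | a in Ax].

(* The set P^S(B(x)). *)
Definition safe : set PB :=
  [set piB | concentrated R Bx piB /\
     forall piA, concentrated R Ax piA -> payoff_defined piA piB].

(* The set P^sharp_l(A(x)), as a subset of P(A). *)
Definition sharp_level (A : set TA) (l : R) : set (weakP R A) :=
  [set piA | concentrated R Ax (weakP_val piA) /\
     payoff_sharp (weakP_val piA) <= l%:E].

End game.

Section family.
Context {R : realType} {TX TA TB : ptopologicalType}.

(* K-inf-compactness on Gr(A~) of (x, b, a) |-> c x a b. *)
Definition K_inf_compact (KA : set (TX * TA)) (KB : set (TX * TB))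
    (c : TX -> TA -> TB -> R) : Prop :=
  forall (C : set (TX * TB)) (l : R), C !=set0 -> compact C -> C `<=` KB ->
    compact [set xba : TX * TB * TA |
      [/\ C xba.1, KA (xba.1.1, xba.2) & c xba.1.1 xba.2 xba.1.2 <= l]].

(* Berge lower semi-continuity of F on the subspace X. *)
Definition lsc_correspondence (X : set TX) (F : TX -> set TB) : Prop :=
  forall x, X x -> forall V : set TB, open V -> F x `&` V !=set0 ->
    \forall z \near within X (nbhs x), F z `&` V !=set0.

End family.

(* Main.v *)
Require Import Defs.
From HB Require Import structures.
From mathcomp Require Import all_boot all_order all_algebra.
From mathcomp Require Import ring lra.
From mathcomp Require Import all_classical all_reals all_analysis measurable_realfun.

Set Implicit Arguments.
Unset Strict Implicit.
Unset Printing Implicit Defensive.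

Import Order.TTheory GRing.Theory Num.Theory.
Import numFieldNormedType.Exports.

Local Open Scope classical_set_scope.
Local Open Scope ring_scope.

(* The game is lifted to [TA]: the payoff, extended by [+oo] outside the section
   of [KA], is jointly lower semicontinuous by K-inf-compactness, so the level
   sets of the integrated payoff are closed under weak limits, and, by Markov's
   inequality and Prokhorov's theorem, compact as long as the pair (x, b) stays
   in a compact set. Since B is lower semicontinuous, every b in B(x) can be
   approached when x varies, whence the set of all (x, pi) with
   payoff_sharp pi <= l is closed and v is lower semicontinuous.
   For the minimax equality, if no mixed strategy guarantees l, compactness
   yields finitely many pure strategies b such that every mixed strategy of the
   first player pays at least l against one of them, and a finite convexity
   argument turns them into one mixed strategy. The converse inequality is Tonelli's theorem.
   For the selection, the sets of points x at which some optimal measure lies in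
   a given closed set are Borel, and this property survives the successive
   minimisation of countably many lower semicontinuous functions that separate
   measures. *)

(** * Finite minimax *)

(** [K_inf_compact] speaks only of compact sets of pairs (x, b). A convergent sequence of pairs
    together with its limit is such a set; this yields the joint lower semicontinuity and the local
    lower bounds of the payoff. The payoff is unbounded and its expectation is a difference of two
    possibly infinite integrals. Adding a constant [m], valid for all pairs near a given one, turns
    it into the integral of one nonnegative function. With the value [+oo] outside the section, a
    finite integral forces concentration on the section, so that this constraint passes to weak
    limits together with the bound on the payoff. Elements of [probability] that agree on Borel sets
    are not separated by the weak topology. Limits of measures are therefore taken along filters and
    ultrafilters, and the selection determines its value up to indistinguishability. In the finite
    minimax step a mixed strategy of the first player may have payoff [+oo]. The argument is run on
    the measures with finite payoff against every pure [b]; Dirac measures are among them, and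
    [payoff_flat] evaluates only those. *)

Section finite_minimax.
Context {R : realType} {S : Type}.
Variable Y : set (S -> R).
Hypothesis Yconv : forall (t : R) (f g : S -> R), 0 <= t <= 1 -> Y f -> Y g ->
  Y (fun s => t * f s + (1 - t) * g s).

(** Probability measures carry no vector space structure, so a convex combination is described only
    by its values under the functions of [Y]. *)
Definition affinely_convex (P : set S) := forall (t : R) (s s' : S),
  0 <= t <= 1 -> P s -> P s' ->
  exists2 u, P u & forall f, Y f -> f u = t * f s + (1 - t) * f s'.

(** A coefficient [tau >= 0] with [tau * f + g >= 0] on [P] must exceed every [- g s / f s] with
    [g s < 0] and stay below every [g s / - f s] with [f s < 0]. If a lower bound exceeded an upper
    one, some mixture of the two points would make both functions negative. *)
Lemma minimax2 (P : set S) (f g : S -> R) : affinely_convex P -> Y f -> Y g ->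
  (forall s, P s -> 0 <= f s \/ 0 <= g s) ->
  exists2 h, Y h & forall s, P s -> 0 <= h s.
Proof.
move=> Pconv Yf Yg fg.
have [f0|/existsNP[s0 /not_implyP[Ps0 /negP]]] := pselect (forall s, P s -> 0 <= f s).
  by exists f.
rewrite -ltNge => fs0.
have [g0|/existsNP[s1 /not_implyP[Ps1 /negP]]] := pselect (forall s, P s -> 0 <= g s).
  by exists g.
rewrite -ltNge => gs1.
have key s s' : P s -> P s' -> f s < 0 -> g s' < 0 -> g s' * f s <= g s * f s'.
  move=> Ps Ps' fs gs'; rewrite leNgt; apply/negP => lt.
  have gs : 0 <= g s by case: (fg s Ps) => //; rewrite leNgt fs.
  have fs' : 0 <= f s' by case: (fg s' Ps') => //; rewrite [in X in X -> _]leNgt gs'.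
  (* The weight [(f s' - g s') / D] is the one at which [f] and [g] take the same value,
     [(g s * f s' - g s' * f s) / D], which is negative by [lt]. *)
  pose D := - f s + f s' + g s - g s'.
  have D0 : 0 < D by rewrite /D; lra.
  have t01 : 0 <= (f s' - g s') / D <= 1.
    apply/andP; split; first by apply: divr_ge0; lra.
    by rewrite ler_pdivrMr// /D; lra.
  have [u Pu hu] := Pconv _ _ _ t01 Ps Ps'.
  have E : 1 - (f s' - g s') / D = (g s - f s) / D.
    by rewrite -[X in X - _](@divff _ D) ?gt_eqF// -mulrBl; congr (_ / _); rewrite /D; ring.
  have Di : 0 < D^-1 by rewrite invr_gt0.
  have fu : f u < 0.
    rewrite hu// E (_ : _ + _ = (g s * f s' - g s' * f s) * D^-1); last by ring.
    by rewrite pmulr_llt0// subr_lt0.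
  have gu : g u < 0.
    rewrite hu// E (_ : _ + _ = (g s * f s' - g s' * f s) * D^-1); last by ring.
    by rewrite pmulr_llt0// subr_lt0.
  by case: (fg u Pu) => H; lra.
have f_gt0 s : P s -> g s < 0 -> 0 < f s.
  move=> Ps gs; have fs : 0 <= f s by case: (fg s Ps) => //; rewrite leNgt gs.
  rewrite lt_neqAle fs andbT; apply/negP => /eqP fs0'.
  have := key _ _ Ps0 Ps fs0 gs; rewrite -fs0' mulr0 leNgt.
  by rewrite nmulr_rgt0// fs0.
pose E := [set - g s / f s | s in [set s | P s /\ g s < 0]].
have E1 : E (- g s1 / f s1) by exists s1.
have Eub s : P s -> f s < 0 -> ubound E (g s / - f s).
  move=> Ps fs _ [s' [Ps' gs'] <-].
  have fs' := f_gt0 _ Ps' gs'.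
  rewrite ler_pdivrMr// mulrAC ler_pdivlMr ?oppr_gt0//.
  by rewrite mulrNN; exact: key.
have hE : has_sup E by split; [exists (- g s1 / f s1)|exists (g s0 / - f s0); exact: Eub].
pose tau := sup E.
have tau0 : 0 <= tau.
  apply: (@le_trans _ _ (- g s1 / f s1)); last exact: sup_upper_bound.
  by apply: divr_ge0; [lra | exact/ltW/f_gt0].
have tau1 : 0 < 1 + tau by lra.
(* Dividing [tau * f + g] by [1 + tau] makes it a convex combination. *)
have t01 : 0 <= tau / (1 + tau) <= 1.
  by apply/andP; split; [apply: divr_ge0; lra | rewrite ler_pdivrMr//; lra].
exists (fun s => (tau / (1 + tau)) * f s + (1 - tau / (1 + tau)) * g s).
  exact: Yconv.
move=> s Ps.
have -> : tau / (1 + tau) * f s + (1 - tau / (1 + tau)) * g s =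
    (tau * f s + g s) / (1 + tau) by field; lra.
apply: divr_ge0; last lra.
have [fs|fs] := ltP (f s) 0.
  have : tau <= g s / - f s by apply: ge_sup; [exists (- g s1 / f s1)|exact: Eub].
  by rewrite ler_pdivlMr ?oppr_gt0//; lra.
have [gs|gs] := ltP (g s) 0; last by apply: addr_ge0 => //; exact: mulr_ge0.
have : - g s / f s <= tau by apply: sup_upper_bound => //; exists s.
by rewrite ler_pdivrMr ?f_gt0//; lra.
Qed.

(* Induction on [l]: the functions of the tail are treated on the part of [P]
   where the head is negative, and their combination is then paired with it. *)
Lemma finite_minimax (I : eqType) (f : I -> S -> R) (l : seq I) (P : set S) :
  P !=set0 -> affinely_convex P -> (forall i, i \in l -> Y (f i)) ->
  (forall s, P s -> exists2 i, i \in l & 0 <= f i s) ->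
  exists2 h, Y h & forall s, P s -> 0 <= h s.
Proof.
elim: l P => [|i l IH] P P0 Pconv Yf fge0.
  by have [s Ps] := P0; have [] := fge0 s Ps.
have Yfi : Y (f i) by apply: Yf; rewrite mem_head.
have [[s0 Ps0]|Pempty] := pselect (P `&` [set s | f i s < 0] !=set0); last first.
  exists (f i) => // s Ps; rewrite leNgt; apply/negP => fs.
  by apply: Pempty; exists s.
have [|t s s' t01 [Ps fs] [Ps' fs']|j jl|s [Ps fs]|h Yh hge0] :=
    IH (P `&` [set s | f i s < 0]).
- by exists s0.
- have [u Pu hu] := Pconv t s s' t01 Ps Ps'; exists u => //; split=> //=.
  rewrite hu//; rewrite /= in fs fs'; move: t01 => /andP[t0 t1].
  (* Strict negativity comes from [f i s] when [t] is positive, and from [f i s'] when [t = 0]. *)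
  have [->|tn0] := eqVneq t 0; first by rewrite mul0r add0r subr0 mul1r.
  have : t * f i s < 0 by rewrite pmulr_rlt0// lt0r tn0.
  have : (1 - t) * f i s' <= 0 by rewrite mulr_ge0_le0//; [lra|exact: ltW].
  by lra.
- by apply: Yf; rewrite inE jl orbT.
- have [j] := fge0 s Ps; rewrite inE => /orP[/eqP ->|jl fj]; last by exists j.
  by rewrite leNgt fs.
- apply: (minimax2 Pconv Yh Yfi) => s Ps.
  have [fs|fs] := leP 0 (f i s); first by right.
  by left; apply: hge0.
Qed.

End finite_minimax.

(** * Borel sets and Borel selections *)

Section borel_sets.
Context {T : topologicalType}.
Implicit Types (A B : set T).

Lemma borel_open A : open A -> borel A.
Proof. exact: sub_sigma_algebra. Qed.

Lemma borelC A : borel A -> borel (~` A).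
Proof. by move=> bA; rewrite -setTD; exact: sigma_algebraCD. Qed.

Lemma borel_closed A : closed A -> borel A.
Proof.
move=> cA; rewrite -(setCK A); apply: borelC; apply: borel_open.
exact: closed_openC.
Qed.

Lemma borel_bigcup (I : countType) (F : I -> set T) :
  (forall i, borel (F i)) -> borel (\bigcup_i F i).
Proof.
move=> bF; rewrite (_ : \bigcup_i F i =
    \bigcup_n (if @unpickle I n is Some i then F i else set0)); last first.
  apply/seteqP; split=> [x [i _ Fx]|x [n _]]; first by exists (pickle i) => //; rewrite pickleK.
  by case: unpickle => // i Fx; exists i.
apply: sigma_algebra_bigcup => n; case: unpickle => //.
exact: sigma_algebra0.
Qed.

Lemma borel_bigcap (I : countType) (F : I -> set T) :
  (forall i, borel (F i)) -> borel (\bigcap_i F i).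
Proof.
move=> bF; rewrite -(setCK (\bigcap_i F i)); apply: borelC.
by rewrite setC_bigcap; apply: borel_bigcup => i; exact: borelC.
Qed.

Lemma borelU A B : borel A -> borel B -> borel (A `|` B).
Proof.
move=> bA bB; rewrite (_ : A `|` B = \bigcup_b (if b then A else B)).
  by apply: borel_bigcup => -[].
apply/seteqP; split=> [x [Ax|Bx]|x [[|] _ ?]]; by [exists true|exists false|left|right].
Qed.

End borel_sets.

Lemma borel_fun_open (S T : topologicalType) (f : S -> T) :
  (forall U, open U -> borel (f @^-1` U)) -> borel_fun f.
Proof.
move=> fo U; apply: (@smallest_sub _ _ _ [set V | borel (f @^-1` V)]) => //.
split => [|V bV|F bF].
- by rewrite /= preimage_set0; exact: sigma_algebra0.
- by rewrite /= setTD; exact: (borelC bV).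
- by rewrite /= preimage_bigcup; exact: sigma_algebra_bigcup.
Qed.

Lemma continuous_borel_fun (S T : topologicalType) (f : S -> T) :
  continuous f -> borel_fun f.
Proof. by move=> /continuousP cf; apply: borel_fun_open => U /cf; exact: borel_open. Qed.

Lemma compact_directed_bigcap (T : topologicalType) (I : Type) (D : set I)
    (K : set T) (F : I -> set T) : compact K -> D !=set0 ->
  (forall i, D i -> closed (F i)) ->
  (forall i, D i -> K `&` F i !=set0) ->
  (forall i j, D i -> D j -> exists2 k, D k & F k `<=` F i `&` F j) ->
  K `&` \bigcap_(i in D) F i !=set0.
Proof.
move=> cK [i0 Di0] clF F0 Fdir.
have PF : ProperFilter (filter_from D (fun i => K `&` F i)).
  apply: filter_from_proper; last by move=> i /F0.
  apply: filter_from_filter; first by exists i0.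
  by move=> i j Di Dj; have [k Dk kij] := Fdir i j Di Dj; exists k => // x [Kx /kij[]].
have [|p [Kp clp]] := cK _ PF; first by exists i0 => // x [].
exists p; split => // i Di; apply: clF => // B Bp; apply: clp => //.
by exists i => // x [].
Qed.

(** * Measurable compact-valued maps and their selections *)

Section borel_selection.
Context {R : realType} {X Y : topologicalType}.

(** Measurability of a set-valued map, tested on closed rather than open sets: this form survives
    intersection of [M] with a fixed closed set. *)
Definition closed_measurable (M : X -> set Y) : Prop :=
  forall D : set Y, closed D -> borel [set x | M x `&` D !=set0].

(** [L x (m x)] is the decreasing intersection of the levels [L x q] over rational [q] above [m x],
    and compactness lets hitting [D] pass to the intersection. Levels below [m x] are empty, so the
    comparison of [q] with [m x] can be replaced by the alternative that [L x q] is empty, whose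
    Borel measurability is known. *)
Lemma closed_measurable_level (L : X -> R -> set Y) (m : X -> R) :
  (forall x (p q : R), p <= q -> L x p `<=` L x q) ->
  (forall x q, closed (L x q)) -> (forall x q, compact (L x q)) ->
  (forall x q y, (forall r, q < r -> L x r y) -> L x q y) ->
  (forall q, closed_measurable (L^~ q)) ->
  (forall x, L x (m x) !=set0) ->
  (forall x q, q < m x -> L x q = set0) ->
  closed_measurable (fun x => L x (m x)).
Proof.
move=> Lmono Lcl Lco Lr bL L0 Lm D clD.
rewrite (_ : [set x | _] = \bigcap_(q : rat) (~` [set x | L x (ratr q) `&` setT !=set0] `|`
    [set x | L x (ratr q) `&` D !=set0])); last first.
  apply/seteqP; split=> [x /= [y [Ly Dy]] q _|x /= H].
    have [qm|mq] := ltP (ratr q) (m x); last by right; exists y; split => //; apply: Lmono Ly.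
    by left; rewrite /= (Lm _ _ qm) => -[? []].
  have [|||||y [_ Hy]] := @compact_directed_bigcap _ R [set r | m x < r]
      (L x (m x + 1)) (fun r => L x r `&` D).
  - exact: Lco.
  - by exists (m x + 1) => /=; rewrite ltrDl ltr01.
  - by move=> r _; apply: closedI => //.
  - move=> r /= mr; have [q /andP[]] : exists q, (m x < ratr q) && (ratr q < Num.min r (m x + 1)).
      have : m x < Num.min r (m x + 1) by rewrite lt_min mr ltrDl ltr01.
      by move=> /rat_in_itvoo[q]; rewrite in_itv/= => ?; exists q.
    rewrite lt_min => mq /andP[qr q1].
    have [/= []|/= [y [Ly Dy]]] := H q I.
      have [y Ly] := L0 x; exists y; split => //; apply: Lmono Ly; exact: ltW.
    by exists y; split; [|split] => //; apply: Lmono Ly; exact: ltW.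
  - move=> r s /= mr ms; exists (Num.min r s); first by rewrite /= lt_min mr.
    by move=> y [Ly Dy]; do 2 split => //; apply: Lmono Ly; rewrite ge_min lexx ?orbT.
  exists y; split; first by apply: Lr => r /Hy[].
  have [] // := Hy (m x + 1); first by rewrite /= ltrDl ltr01.
apply: borel_bigcap => q; apply: borelU; last exact: bL.
by apply: borelC; apply: bL; exact: closedT.
Qed.

Definition argmin_on (u : Y -> R) (M : X -> set Y) (x : X) : set Y :=
  M x `&` [set y | forall z, M x z -> u y <= u z].

(** With [y0 x] any minimiser, the argmin is the level of [u] on [M x] at height [u (y0 x)], and
    below this height the level is empty; [closed_measurable_level] then applies. *)
Lemma argmin_onP (u : Y -> R) (M : X -> set Y) :
  (forall q, closed [set y | u y <= q]) ->
  (forall x, [/\ M x !=set0, closed (M x) & compact (M x)]) ->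
  closed_measurable M ->
  (forall x, [/\ argmin_on u M x !=set0, closed (argmin_on u M x) &
    compact (argmin_on u M x)]) /\ closed_measurable (argmin_on u M).
Proof.
move=> clu hM bM.
have argminE x : argmin_on u M x = M x `&` \bigcap_(z in M x) [set y | u y <= u z] by [].
have clarg x : closed (\bigcap_(z in M x) [set y | u y <= u z]).
  by apply: closed_bigI => z _; exact: clu.
have arg0 x : argmin_on u M x !=set0.
  have [M0 clM coM] := hM x; rewrite argminE; apply: compact_directed_bigcap => //.
    by move=> z Mz; exists z; split => //=.
  move=> y z My Mz; have [yz|/ltW zy] := leP (u y) (u z).
    by exists y => // w /= wy; split => //; exact: le_trans yz.
  by exists z => // w /= wz; split => //; exact: le_trans zy.
split=> [x|].
  have [M0 clM coM] := hM x; split => //; rewrite argminE; first exact: closedI.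
  exact: compact_closedI.
have [y0 y0P] := choice arg0.
have -> : argmin_on u M = (fun x => M x `&` [set y | u y <= u (y0 x)]).
  apply/funext => x; apply/seteqP; split=> y [My Hy]; split => //=.
    by apply: Hy; have [] := y0P x.
  by move=> z Mz; apply: le_trans Hy _; have [_] := y0P x; apply.
apply: (@closed_measurable_level (fun x q => M x `&` [set y | u y <= q]) (fun x => u (y0 x))).
- by move=> x p q pq y [My uy]; split => //; exact: le_trans pq.
- by move=> x q; have [_ ? _] := hM x; exact: closedI.
- by move=> x q; have [_ _ ?] := hM x; exact: compact_closedI.
- move=> x q y H; split; first by have [] := H (q + 1); rewrite ?ltrDl.
  by apply/ler_addgt0Pr => e e0; have [] := H (q + e); rewrite ?ltrDl.
- move=> q D clD; rewrite (_ : [set x | _] =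
      [set x | M x `&` ([set y | u y <= q] `&` D) !=set0]); last first.
    by apply/seteqP; split=> x /=; rewrite setIA.
  by apply: bM; exact: closedI.
- by move=> x; exists (y0 x); split => //=; have [] := y0P x.
- move=> x q qm; rewrite -subset0 => y [My /= uy].
  by have [_ /(_ y My)] := y0P x; rewrite leNgt (le_lt_trans uy qm).
Qed.

(* Minimising the [u k] one after the other leaves in [M x] a single point up
   to topological indistinguishability. *)
Lemma compact_borel_selection (M : X -> set Y) (u : nat -> Y -> R) :
  (forall x, [/\ M x !=set0, closed (M x) & compact (M x)]) ->
  closed_measurable M ->
  (forall k q, closed [set y | u k y <= q]) ->
  (forall y z, (forall k, u k y = u k z) -> forall G, open G -> G y -> G z) ->
  exists f : X -> Y, borel_fun f /\ forall x, M x (f x).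
Proof.
move=> hM bM clu usep.
pose N := fix N k := if k is k'.+1 then argmin_on (u k') (N k') else M.
have NP k : (forall x, [/\ N k x !=set0, closed (N k x) & compact (N k x)]) /\
    closed_measurable (N k).
  by elim: k => [//|k [IH1 IH2]]; exact: argmin_onP.
have Nanti k l x : (k <= l)%N -> N l x `<=` N k x.
  move=> kl; rewrite -(subnK kl); elim: (l - k)%N => // j IH y [/IH].
  by [].
have NDP x D : closed D -> (forall k, N k x `&` D !=set0) ->
    M x `&` \bigcap_(k in setT) (N k x `&` D) !=set0.
  move=> clD ND; have [_ _ coM] := hM x; apply: compact_directed_bigcap => //.
  - by move=> k _; apply: closedI => //; have [/(_ x)[]] := NP k.
  - move=> k _; have [y [Ny Dy]] := ND k; exists y; split => //.
    exact: (Nanti 0%N k x (leq0n k)) Ny.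
  - move=> k l _ _; exists (maxn k l) => // y [Ny Dy].
    by do 2 split => //; apply: Nanti Ny; rewrite ?leq_maxl ?leq_maxr.
have N0 x : exists y, forall k, N k x y.
  have [|k|y [_ Hy]] := NDP x setT; first exact: closedT.
    by rewrite setIT; have [/(_ x)[]] := NP k.
  by exists y => k; have [] := Hy k I.
have [f fP] := choice N0; exists f; split; last by move=> x; exact: (fP x 0%N).
have uE x y z k : (forall l, N l x y) -> (forall l, N l x z) -> u k y = u k z.
  move=> Ny Nz; apply/eqP; rewrite eq_le.
  have [_ /(_ _ (Nz k)) yz] := Ny k.+1; have [_ /(_ _ (Ny k)) zy] := Nz k.+1.
  by rewrite yz zy.
apply: borel_fun_open => U oU; rewrite -(setCK U) preimage_setC; apply: borelC.
(* If all [N k x] meet the complement of [U], compactness gives a common point there. All [u k]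
   agree at it and at [f x], so the two are indistinguishable and [f x] is outside [U] too. *)
rewrite [X in borel X](_ : _ = \bigcap_k [set x | N k x `&` ~` U !=set0]); last first.
  apply/seteqP; split=> [x Ufx k _|x H]; first by exists (f x).
  have [|k|y [_ Hy]] := NDP x (~` U); [exact: open_closedC|exact: H|].
  move=> /= Ufx; have [_] := Hy 0%N I; apply; apply: (usep (f x)) => // k.
  by apply: (uE x) => // l; have [] := Hy l I.
apply: borel_bigcap => k; have [_] := NP k; apply; exact: open_closedC.
Qed.

End borel_selection.

(** * Limits of tight families of probability measures *)

(** The portmanteau inequality: the lower limit of [mu i G] is at least [pi G] for open [G]. It
    makes sense for measures on all of [T], before the limit is known to be concentrated on a given
    set. *)
Definition open_cvg {R : realType} {T : ptopologicalType} {I : Type}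
    (F : set_system I) (mu : I -> probability (borelType T) R)
    (pi : probability (borelType T) R) : Prop :=
  forall G : set T, open G -> forall r : R, (r%:E < pi G)%E ->
    \forall i \near F, (r%:E < mu i G)%E.

Lemma ultra_cvg_segment (R : realType) (I : Type) (U : set_system I)
    (f : I -> R) : UltraFilter U -> (forall i, 0 <= f i <= 1) -> cvg (f @ U).
Proof.
move=> UU f01; have := @segment_compact R 0 1.
move=> /(_ (f @ U) _)[|p [_ clp]].
  by apply: nearW => i /=; rewrite in_itv/= f01.
apply/cvg_ex; exists p => N Np.
have [//|UN] := in_ultra_setVsetC (f @^-1` N) UU.
by have [x []] := clp (~` N) N UN Np.
Qed.

(** [K] minus [G] and [K] minus [H] are disjoint closed sets; removing from [K] disjoint open
    neighbourhoods of them leaves the two pieces. *)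
Lemma compact_split (R : realType) (T : pseudoMetricType R) (K G H : set T) :
  hausdorff_space T -> compact K -> open G -> open H -> K `<=` G `|` H ->
  exists K1 K2 : set T, [/\ compact K1, compact K2, K1 `<=` G, K2 `<=` H &
    K `<=` K1 `|` K2].
Proof.
move=> hT cK oG oH KGH; have clK := compact_closed hT cK.
have /normal_openP := @pseudometric_normal R T.
move=> /(_ R (K `\` G) (K `\` H))[||| V [W [oV oW KV KW VW]]].
- by apply: closedI => //; exact: open_closedC.
- by apply: closedI => //; exact: open_closedC.
- rewrite -subset0 => x [[Kx nG] [_ nH]].
  by case: (KGH _ Kx).
exists (K `\` V), (K `\` W); split.
- by apply: compact_closedI => //; exact: open_closedC.
- by apply: compact_closedI => //; exact: open_closedC.
- by move=> x [Kx nVx]; apply: contrapT => nG; apply: nVx; exact: KV.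
- by move=> x [Kx nVx]; apply: contrapT => nG; apply: nVx; exact: KW.
move=> x Kx; have [Vx|?] := pselect (V x); last by left.
right; split => // Wx; have : (V `&` W) x by [].
by rewrite VW.
Qed.

Section prokhorov.
Context {R : realType} {T : completePseudoMetricType R} {I : Type}.
Variables (U : set_system I) (mu : I -> probability (borelType T) R).
Context {UU : UltraFilter U}.
Hypothesis hT : hausdorff_space T.
Local Open Scope ereal_scope.
Local Notation mT := (measurable : set (set (borelType T))).

Let alpha (S : set T) : R := lim ((fun i => fine (mu i S)) @ U).

Let mK (K : set T) : compact K -> mT K.
Proof. by move=> /(compact_closed hT) /borel_closed. Qed.

Let fin_mu i (S : set T) : mT S -> mu i S \is a fin_num.
Proof. by move=> mS; rewrite fin_num_measure. Qed.

Let alpha_cvg (S : set T) : mT S -> (fun i => fine (mu i S)) @ U --> alpha S.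
Proof.
move=> mS; apply: ultra_cvg_segment => i; apply/andP; split.
  by rewrite fine_ge0.
by rewrite -lee_fin fineK ?fin_mu// probability_le1.
Qed.

Let le_cvg (f g : I -> R) (k l : R) : f @ U --> k -> g @ U --> l ->
  (forall i, f i <= g i)%R -> (k <= l)%R.
Proof.
move=> fk gl fg; rewrite -subr_ge0; apply: (cvgr_to_ge (cvgB gl fk)).
by apply: nearW => i; rewrite subr_ge0.
Qed.

Let alpha_ge (S : set T) (r : R) : mT S -> (\forall i \near U, r%:E <= mu i S) ->
  (r <= alpha S)%R.
Proof.
move=> mS H; apply: (cvgr_to_ge (alpha_cvg mS)).
by move: H; apply: filterS => i; rewrite -{1}(fineK (fin_mu i mS)) lee_fin.
Qed.

Let alpha_le (S S' : set T) : mT S -> mT S' -> S `<=` S' -> (alpha S <= alpha S')%R.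
Proof.
move=> mS mS' SS'; apply: (le_cvg (alpha_cvg mS) (alpha_cvg mS')).
by move=> i; rewrite fine_le ?fin_mu// le_measure ?inE.
Qed.

Let alpha_le1 (S : set T) : mT S -> (alpha S <= 1)%R.
Proof.
move=> mS; apply: (cvgr_to_le (alpha_cvg mS)).
by apply: nearW => i; rewrite -lee_fin fineK ?fin_mu// probability_le1.
Qed.

Let alphaU (S S' : set T) : mT S -> mT S' ->
  (alpha (S `|` S') <= alpha S + alpha S')%R.
Proof.
move=> mS mS'; have mSS' : mT (S `|` S') by exact: measurableU.
apply: (le_cvg (alpha_cvg mSS') (cvgD (alpha_cvg mS) (alpha_cvg mS'))).
move=> i; rewrite -[leRHS]/(fine (mu i S) + fine (mu i S'))%R -fineD ?fin_mu// fine_le ?fin_mu//.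
  by rewrite fin_numD !fin_mu.
exact: measureU2.
Qed.

Let alphaU_disj (S S' : set T) : mT S -> mT S' -> S `&` S' = set0 ->
  (alpha S + alpha S' <= alpha (S `|` S'))%R.
Proof.
move=> mS mS' SS'; have mSS' : mT (S `|` S') by exact: measurableU.
apply: (le_cvg (cvgD (alpha_cvg mS) (alpha_cvg mS')) (alpha_cvg mSS')).
by move=> i; rewrite -[leLHS]/(fine (mu i S) + fine (mu i S'))%R -fineD ?fin_mu// measureU.
Qed.

Let alpha0 : alpha set0 = 0%R.
Proof.
rewrite /alpha (_ : (fun i => _) = cst 0%R) ?lim_cst//.
by apply/funext => i; rewrite measure0.
Qed.

(** The limits [alpha] are finitely additive, but countable additivity may be lost along the
    ultrafilter. It is recovered by approximating open sets from inside by compact ones, and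
    arbitrary sets from outside by open ones. *)
Let beta (G : set T) : \bar R :=
  ereal_sup [set (alpha K)%:E | K in [set K | compact K /\ K `<=` G]].

Let gamma (M : set T) : \bar R :=
  ereal_inf [set beta G | G in [set G | open G /\ M `<=` G]].

Let beta_ge (K G : set T) : compact K -> K `<=` G -> (alpha K)%:E <= beta G.
Proof. by move=> cK KG; apply: ereal_sup_ubound; exists K. Qed.

Let beta_ge0 (G : set T) : 0 <= beta G.
Proof. by rewrite -[0]/(0%R%:E) -alpha0; apply: beta_ge => //; exact: compact0. Qed.

Let beta_le (G : set T) x : (forall K, compact K -> K `<=` G -> (alpha K)%:E <= x) ->
  beta G <= x.
Proof. by move=> H; apply: ge_ereal_sup => _ [K [cK KG] <-]; exact: H. Qed.

Let gamma_le (M G : set T) : open G -> M `<=` G -> gamma M <= beta G.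
Proof. by move=> oG MG; apply: ereal_inf_lbound; exists G. Qed.

Let gamma_ge0 (M : set T) : 0 <= gamma M.
Proof. by apply: le_ereal_inf_tmp => _ [G _ <-]; exact: beta_ge0. Qed.

Let gamma_open (G : set T) : open G -> gamma G = beta G.
Proof.
move=> oG; apply/eqP; rewrite eq_le gamma_le//=.
apply: le_ereal_inf_tmp => _ [H [oH GH] <-].
by apply: beta_le => K cK KG; apply: beta_ge => //; exact: subset_trans GH.
Qed.

Let beta_le1 (G : set T) : beta G <= 1.
Proof. by apply: beta_le => K cK _; rewrite lee_fin alpha_le1//; exact: mK. Qed.

Let gamma_fin (M : set T) : gamma M \is a fin_num.
Proof.
rewrite ge0_fin_numE//; apply: (@le_lt_trans _ _ 1); last exact: ltry.
by apply: le_trans (beta_le1 setT); apply: gamma_le => //; exact: openT.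
Qed.

Let gamma_homo : {homo gamma : A B / A `<=` B >-> A <= B}.
Proof.
move=> A B AB; apply: le_ereal_inf_tmp => _ [G [oG BG] <-].
by apply: gamma_le => //; exact: subset_trans BG.
Qed.

Let gamma0 : gamma set0 = 0.
Proof.
rewrite gamma_open; last exact: open0.
apply/eqP; rewrite eq_le beta_ge0 andbT; apply: beta_le => K _.
by rewrite subset0 => ->; rewrite alpha0.
Qed.

Let alpha_bigU (G : (set T)^nat) n (K : set T) : (forall i, open (G i)) ->
  compact K -> K `<=` \big[setU/set0]_(i < n) G i ->
  (alpha K)%:E <= \sum_(0 <= i < n) beta (G i).
Proof.
move=> oG; elim: n K => [|n IH] K cK.
  by rewrite big_ord0 subset0 => ->; rewrite alpha0 big_geq.
rewrite big_ord_recr/= => KG.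
have oGn : open (\big[setU/set0]_(i < n) G i).
  by rewrite -bigcup_mkord; apply: bigcup_open => i _; exact: oG.
have [K1 [K2 [cK1 cK2 K1G K2G K12]]] := compact_split hT cK oGn (oG n) KG.
rewrite big_nat_recr//=.
apply: (@le_trans _ _ ((alpha K1)%:E + (alpha K2)%:E)).
  rewrite -EFinD lee_fin; apply: le_trans (alphaU (mK cK1) (mK cK2)).
  by apply: alpha_le => //; [exact: mK|apply: measurableU; exact: mK].
by apply: leeD; [exact: IH|exact: beta_ge].
Qed.

Let gamma_subadd : sigma_subadditive gamma.
Proof.
move=> M.
suff add2e (e : {posnum R}) :
    gamma (\bigcup_n M n) <= \sum_(i <oo) gamma (M i) + e%:num%:E.
  by apply/lee_addgt0Pr => _/posnumP[].
rewrite (le_trans _ (epsilon_trick _ _ _))//.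
have /choice[G HG] n : exists G, [/\ open G, M n `<=` G &
    beta G <= gamma (M n) + (e%:num / (2 ^ n.+1)%:R)%:E].
  have en1 : (0 < e%:num / (2 ^ n.+1)%:R :> R)%R by [].
  have [_ [G [oG MG] <-] Ge] := lb_ereal_inf_adherent en1 (gamma_fin (M n)).
  by exists G; split => //; exact: ltW.
apply: (@le_trans _ _ (\sum_(i <oo) beta (G i))); last first.
  by apply: lee_nneseries => // i _; have [] := HG i.
have oG i : open (G i) by have [] := HG i.
apply: (@le_trans _ _ (beta (\bigcup_n G n))).
  apply: gamma_le; first by apply: bigcup_open => i _; exact: oG.
  by move=> x [i _ Mx]; exists i => //; have [_ + _] := HG i; apply.
apply: beta_le => K cK KG.
have [n Kn] : exists n, K `<=` \big[setU/set0]_(i < n) G i.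
  have := cK; rewrite compact_cover => /(_ nat setT G).
  move=> [i _|//|D _ KD]; first exact: oG.
  exists (\max_(i <- finmap.enum_fset D) i).+1; apply: subset_trans KD _ => x [i iD Gx].
  rewrite -bigcup_mkord; exists i => //=; rewrite ltnS.
  by rewrite (big_rem i)//= leq_maxl.
apply: le_trans (alpha_bigU oG cK Kn) _.
exact: nneseries_lim_ge.
Qed.

Let gamma_outer : isOuterMeasure R T gamma :=
  isOuterMeasure.Build R T gamma gamma0 gamma_ge0 gamma_homo gamma_subadd.

Let gam : {outer_measure set T -> \bar R} := HB.pack gamma gamma_outer.

(** For an open [H] containing [M], choose a compact [K1] nearly exhausting [H] within [G], then a
    compact [K2] nearly exhausting [H] minus [K1], a set that contains [M] minus [G]. As [K1] and
    [K2] are disjoint, their [alpha] values add up to at most [beta H]. *)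
Let gamma_caratheodory_open (G : set T) : open G -> gam.-caratheodory G.
Proof.
move=> oG; apply: le_caratheodory_measurable => M.
change (gamma (M `&` G) + gamma (M `&` ~` G) <= gamma M).
apply: le_ereal_inf_tmp => _ [H [oH MH] <-].
have bfin V : open V -> beta V \is a fin_num by move=> oV; rewrite -gamma_open.
apply/lee_addgt0Pr => e e0.
have e20 : (0 < e / 2)%R by rewrite divr_gt0.
have oHG : open (H `&` G) by exact: openI.
have [_ [K1 [cK1 K1HG] <-] b1] := ub_ereal_sup_adherent e20 (bfin _ oHG).
have oHK : open (H `&` ~` K1).
  by apply: openI => //; apply: closed_openC; exact: compact_closed.
have [_ [K2 [cK2 K2HK] <-] b2] := ub_ereal_sup_adherent e20 (bfin _ oHK).
have g1 : gamma (M `&` G) <= beta (H `&` G) by apply: gamma_le => //; exact: setSI.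
have g2 : gamma (M `&` ~` G) <= beta (H `&` ~` K1).
  apply: gamma_le => // x [Mx nG]; split; first exact: MH.
  by move=> /K1HG[].
apply: le_trans (leeD g1 g2) _.
rewrite [e]splitr EFinD.
apply: (@le_trans _ _ (((alpha K1)%:E + (e / 2)%:E) + ((alpha K2)%:E + (e / 2)%:E))).
  by apply: leeD; rewrite -leeBlDr//; exact: ltW.
rewrite addeACA leeD2r// (@le_trans _ _ (alpha (K1 `|` K2))%:E)//.
  rewrite -EFinD lee_fin; apply: alphaU_disj; [exact: mK|exact: mK|].
  by rewrite -subset0 => x [K1x /K2HK[]].
apply: beta_ge; first exact: compactU.
by move=> x [/K1HG[]|/K2HK[]].
Qed.

Let borel_caratheodory (S : set T) : mT S -> gam.-caratheodory S.
Proof.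
apply: smallest_sub; last exact: gamma_caratheodory_open.
split=> [|V HV|F HF]; first exact: caratheodory_measurable_set0.
  by rewrite setTD; exact: caratheodory_measurable_setC.
exact: caratheodory_measurable_bigcup.
Qed.

Let gammaB (S : set (borelType T)) : \bar R := gamma S.

Let gamma_sigma_additive : semi_sigma_additive gammaB.
Proof.
move=> A mA tA mbigcupA.
apply: (caratheodory_measure_sigma_additive (mu := gam)) => //.
- by move=> n; exact: borel_caratheodory.
- exact: borel_caratheodory.
Qed.

Hypothesis tight : forall e : R, (0 < e)%R -> exists2 K : set T, compact K &
  \forall i \near U, (1 - e)%:E <= mu i K.

Let gamma_setT : gammaB setT = 1.
Proof.
rewrite /gammaB gamma_open; last exact: openT.
apply/eqP; rewrite eq_le beta_le1/=; apply/lee_addgt0Pr => e e0.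
(* Tightness prevents mass from escaping: the limit keeps at least [1 - e] on one compact set. *)
have [K cK UK] := tight e0.
apply: le_trans (leeD2r _ (beta_ge cK (@subsetT _ K))).
by rewrite -EFinD lee_fin -lerBlDr; apply: alpha_ge UK; exact: mK.
Qed.

(* The limit measure is the outer measure [gamma] induced by the ultrafilter
   limits [alpha] on compact sets. *)
Lemma prokhorov : exists pi : probability (borelType T) R, open_cvg U mu pi.
Proof.
pose m1 := isMeasure.Build _ _ _ gammaB gamma0 gamma_ge0 gamma_sigma_additive.
pose m2 : {measure set (borelType T) -> \bar R} := HB.pack gammaB m1.
pose p1 := Measure_isProbability.Build _ _ _ m2 gamma_setT.
pose pi : probability (borelType T) R := HB.pack gammaB m1 p1.
exists pi => G oG r; rewrite -[pi G]/(gamma G) gamma_open//.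
move=> /ereal_sup_gt[_ [K [cK KG] <-]]; rewrite lte_fin => rK.
have Ur : \forall i \near U, (r < fine (mu i K))%R.
  exact: cvgr_gt (alpha_cvg (mK cK)) _ rK.
move: Ur; apply: filterS => i.
rewrite -lte_fin fineK ?fin_mu//; last exact: mK.
move=> /lt_le_trans; apply; apply: le_measure; rewrite ?inE//; first exact: mK.
exact: borel_open.
Qed.

End prokhorov.

(** * Lower semicontinuity of integrals *)

Section staircase.
Context {R : realType} {T : Type}.
Implicit Types (h : T -> \bar R) (t : T).

(* Lower staircase approximation of [h >= 0] with [N] steps of height [d]: its
   integral only involves the measures of the superlevel sets of [h]. *)
Definition staircase (d : R) (N : nat) h t : R :=
  \sum_(k < N) d * \1_[set u | ((k.+1%:R * d)%:E < h u)%E] t.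

Lemma staircase_ge0 (d : R) N h t : 0 <= d -> 0 <= staircase d N h t.
Proof. by move=> d0; apply: sumr_ge0 => k _; rewrite mulr_ge0// indicE. Qed.

Lemma staircase_full (d : R) N h t : 0 <= d -> ((N%:R * d)%:E < h t)%E ->
  staircase d N h t = N%:R * d.
Proof.
move=> d0 ht; rewrite /staircase (eq_bigr (fun=> d)).
  by rewrite sumr_const card_ord mulr_natl.
move=> k _; rewrite indicE mem_set ?mulr1//=.
apply: le_lt_trans ht; rewrite lee_fin ler_wpM2r// ler_nat.
exact: ltn_ord.
Qed.

Lemma staircase_le (d : R) N h t : 0 <= d -> (0 <= h t)%E ->
  ((staircase d N h t)%:E <= h t)%E.
Proof.
move=> d0 h0; elim: N => [|N IH]; first by rewrite /staircase big_ord0.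
have [ht|ht] := ltP ((N.+1%:R * d)%:E)%E (h t).
  by rewrite staircase_full//; exact: ltW.
rewrite /staircase big_ord_recr/= indicE memNset ?mulr0 ?addr0//=.
by apply/negP; rewrite -leNgt.
Qed.

Lemma staircase_ge (d : R) N h t : 0 <= d -> (0 <= h t)%E ->
  (mine (h t) (N%:R * d)%:E <= (staircase d N h t + d)%:E)%E.
Proof.
move=> d0 h0; elim: N => [|N IH].
  by rewrite /staircase big_ord0 add0r mul0r ge_min lee_fin d0 orbT.
have [ht|ht] := ltP ((N%:R * d)%:E)%E (h t).
  apply: (@le_trans _ _ (N.+1%:R * d)%:E); first by rewrite ge_min lexx orbT.
  rewrite lee_fin -natr1 mulrDl mul1r lerD2r -(staircase_full d0 ht).
  by rewrite /staircase big_ord_recr/= lerDl mulr_ge0// indicE.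
apply: (@le_trans _ _ (h t)); first by rewrite ge_min lexx.
move: IH; rewrite min_l// => /le_trans; apply.
by rewrite lee_fin lerD2r /staircase big_ord_recr/= lerDl mulr_ge0// indicE.
Qed.

End staircase.

Section integral_lsc.
Context {R : realType} d {T : measurableType d}.
Implicit Types (pi : probability T R) (h : T -> \bar R).
Local Open Scope ereal_scope.

Lemma emeasurable_fun_superlevel h :
  (forall r : R, measurable [set t | r%:E < h t]) -> measurable_fun setT h.
Proof.
move=> mh; apply: (measurability _ (ErealGenOInfty.measurableE R)).
by move=> _ [_ [r ->] <-]; rewrite setTI preimage_itvoy; exact: mh.
Qed.

Lemma superlevel_measurable h (r : \bar R) : measurable_fun setT h ->
  measurable [set t | r < h t].
Proof. by move=> mh; rewrite -[X in measurable X]setTI; exact: emeasurable_fun_o_infty. Qed.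

Lemma integral_staircase pi (e : R) N h : (0 <= e)%R -> measurable_fun setT h ->
  \int[pi]_t (staircase e N h t)%:E =
  \sum_(k < N) e%:E * pi [set u | (k.+1%:R * e)%:E < h u].
Proof.
move=> e0 mh; rewrite /staircase.
under eq_integral do rewrite -sumEFin.
rewrite ge0_integral_sum//.
- apply: eq_bigr => k _.
  have mk : measurable [set u | (k.+1%:R * e)%:E < h u] by exact: superlevel_measurable.
  rewrite (integralZl_indic measurableT (fun=> [set u | (k.+1%:R * e)%:E < h u]))//.
    by rewrite integral_indic// setIT.
  by move=> /lt_le_trans /(_ e0); rewrite ltxx.
- move=> k; apply/measurable_EFinP; apply: measurable_funM => //.
  by apply: measurable_indic; exact: superlevel_measurable.
- by move=> k t _; rewrite lee_fin mulr_ge0// indicE.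
Qed.

Lemma measurable_staircase (e : R) N h : measurable_fun setT h ->
  measurable_fun setT (staircase e N h).
Proof.
move=> mh; apply: measurable_sum => k; apply: measurable_funM => //.
by apply: measurable_indic; exact: superlevel_measurable.
Qed.

Lemma integral_min_cvg pi (e : R) h : (0 < e)%R -> measurable_fun setT h ->
  (forall t, 0 <= h t) ->
  \int[pi]_t (mine (h t) (n%:R * e)%:E) @[n --> \oo] --> \int[pi]_t h t.
Proof.
move=> e0 mh h0.
rewrite [X in _ --> X](_ : _ = \int[pi]_t limn (fun n => mine (h t) (n%:R * e)%:E)).
  apply: cvg_monotone_convergence => //.
  - by move=> n; apply: measurable_mine.
  - by move=> n t _; rewrite le_min h0 lee_fin mulr_ge0// ltW.
  - move=> t _ m n mn; rewrite le_min ge_min lexx/= ge_min lee_fin.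
    by rewrite ler_wpM2r ?ler_nat ?orbT// ltW.
apply: eq_integral => t _; apply/esym/cvg_lim => //.
case: (h t) (h0 t) => [r| |]// r0; last first.
  rewrite (_ : (fun n => _) = fun n => (n%:R * e)%:E); last first.
    by apply/funext => n; rewrite min_r// leey.
  apply/cvgeryP; apply/cvgryPge => A; near=> n.
  rewrite -ler_pdivrMr//; near: n; exact: nbhs_infty_ger.
apply: cvg_near_cst; near=> n; rewrite min_l// lee_fin -ler_pdivrMr//.
near: n; exact: nbhs_infty_ger.
Unshelve. all: by end_near. Qed.

(** Integrand and measure vary together. Truncating [h] and replacing it by a staircase leaves
    finitely many superlevel sets, to each of which the hypothesis applies; the staircase of [g i]
    bounds [g i] from below. *)
Lemma integral_lsc {I : Type} (F : set_system I) {FF : Filter F}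
    (mu : I -> probability T R) (g : I -> T -> \bar R) pi h :
  measurable_fun setT h -> (forall t, 0 <= h t) ->
  (\forall i \near F, measurable_fun setT (g i) /\ forall t, 0 <= g i t) ->
  (forall l r : R, r%:E < pi [set t | l%:E < h t] ->
    \forall i \near F, r%:E < mu i [set t | l%:E < g i t]) ->
  forall q : R, q%:E < \int[pi]_t h t -> \forall i \near F, q%:E < \int[mu i]_t g i t.
Proof.
move=> mh h0 mg hg q qh.
have [q' qq' q'h] : exists2 q' : R, (q < q')%R & q'%:E < \int[pi]_t h t.
  move: qh; case: (\int[pi]_t h t) => [r| |] //; rewrite ?lte_fin => qr.
    by exists ((q + r) / 2)%R; rewrite ?lte_fin; lra.
  by exists (q + 1)%R; rewrite ?ltry// ltrDl.
(* The staircase of step height [e] falls short of the truncated [h] by at most [e], exactly the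
   room between [q] and [q']. *)
pose e : R := (q' - q)%R; have e0 : (0 < e)%R by rewrite subr_gt0.
have [N qN] : exists N, q'%:E < \int[pi]_t (mine (h t) (N%:R * e)%:E).
  have := @integral_min_cvg pi _ _ e0 mh h0.
  move=> /(_ _ (open_ereal_gt' q'h))[n _ Hn]; exists n.
  by apply: (Hn n) => /=.
pose p k := fine (pi [set t | (k.+1%:R * e)%:E < h t]).
have pE k : pi [set t | (k.+1%:R * e)%:E < h t] = (p k)%:E.
  by rewrite fineK// fin_num_measure//; exact: superlevel_measurable.
have qs : (q < \sum_(k < N) e * p k)%R.
  rewrite -lte_fin -sumEFin; under eq_bigr do rewrite EFinM -pE.
  rewrite -integral_staircase ?(ltW e0)// -(lteD2rE (x := e%:E))//.
  rewrite -EFinD (_ : q + e = q')%R; last by rewrite /e addrC subrK.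
  apply: lt_le_trans qN _.
  have -> : e%:E = \int[pi]_t (cst e%:E) t by rewrite integral_cst//= probability_setT mule1.
  rewrite -ge0_integralD//; last 3 first.
  - by move=> t _; rewrite lee_fin staircase_ge0// ltW.
  - by apply/measurable_EFinP; exact: measurable_staircase.
  - by move=> t _; rewrite /= lee_fin ltW.
  apply: ge0_le_integral => //.
  - by move=> t _; rewrite le_min h0 lee_fin mulr_ge0// ltW.
  - by apply: measurable_mine.
  - by apply: emeasurable_funD => //; apply/measurable_EFinP; exact: measurable_staircase.
  - by move=> t _; rewrite -EFinD; apply: staircase_ge => //; exact: ltW.
pose gap := (\sum_(k < N) e * p k - q)%R; have gap0 : (0 < gap)%R by rewrite subr_gt0.
(* Each of the [N] superlevel sets may lose measure [x]. The total loss [e * x * N] is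
   [gap * N / N.+1], strictly below [gap], also when [N = 0]. *)
pose x := (gap / (e * N.+1%:R))%R.
have x0 : (0 < x)%R by rewrite divr_gt0// mulr_gt0.
have : \forall i \near F, forall k : 'I_N,
    (p k - x)%:E < mu i [set t | (k.+1%:R * e)%:E < g i t].
  by apply: filter_forall => k; apply: hg; rewrite pE lte_fin ltrBlDr ltrDl.
move: mg; apply: filterS2 => i [mgi gi0] H.
apply: (@lt_le_trans _ _ (\int[mu i]_t (staircase e N (g i) t)%:E)); last first.
  apply: ge0_le_integral => //.
  - by move=> t _; rewrite lee_fin staircase_ge0// ltW.
  - by apply/measurable_EFinP; exact: measurable_staircase.
  - by move=> t _; apply: staircase_le => //; exact: ltW.
rewrite integral_staircase ?(ltW e0)//.
apply: (@lt_le_trans _ _ (\sum_(k < N) (e * (p k - x))%:E)); last first.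
  by apply: lee_sum => k _; rewrite EFinM lee_pmul2l//; exact: ltW.
rewrite sumEFin lte_fin.
under eq_bigr do rewrite mulrBr.
rewrite big_split/= sumrN sumr_const card_ord -mulr_natr.
have : (e * x * N%:R < gap)%R.
  rewrite (_ : (_ * _)%R = (gap * (N%:R / N.+1%:R))%R); last first.
    have : N.+1%:R != 0%R :> R by [].
    rewrite /x; move: (N.+1%:R : R) => m m0; field.
    by rewrite m0 gt_eqF.
  by rewrite gtr_pMr// ltr_pdivrMr// mul1r ltr_nat.
rewrite /gap; lra.
Qed.

End integral_lsc.

(** * The weak topology and open sets *)

Lemma initial_cvgP (S : choiceType) (T : topologicalType) (f : S -> T)
    (I : Type) (F : set_system I) (FF : Filter F) (u : I -> initial_topology f)
    (s : initial_topology f) :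
  u @ F --> s <-> (f \o u) @ F --> f s.
Proof.
split=> [us|fus]; first by apply: (cvg_comp _ _ us); exact: initial_continuous.
move=> N [_ [[W oW <-]] /= Ws WN].
have FW : F ((f \o u) @^-1` W) by apply: fus; exact: open_nbhs_nbhs.
by apply: (@filterS _ _ FF _ _ _ FW) => i Wi; exact: WN.
Qed.

Lemma ptws_cvgP (J : Type) (V : topologicalType) (I : Type)
    (F : set_system I) (FF : Filter F) (u : I -> {ptws J -> V}) (s : {ptws J -> V}) :
  u @ F --> s <-> forall j, (fun i => u i j) @ F --> s j.
Proof.
rewrite (cvg_sup (fun j => Topological.class
  (initial_topology (fun g : J -> V => g j)))).
by split=> H j; have /(@initial_cvgP _ _ (fun g : J -> V => g j) I F FF) := H j.
Qed.

Lemma weakP_cvgP (R : realType) (T : ptopologicalType) (E : set T)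
    (I : Type) (F : set_system I) (FF : Filter F) (mu : I -> weakP R E)
    (pi : weakP R E) :
  mu @ F --> pi <-> forall f : T -> R, bounded_continuous E f ->
    (fun i => \int[weakP_val (mu i)]_(t in E) f t) @ F -->
      \int[weakP_val pi]_(t in E) f t.
Proof.
rewrite initial_cvgP ptws_cvgP; split=> H f; last by apply: H; exact: set_valP.
by move=> cf; have := H (SigSub (mem_set cf)).
Qed.

(** * Weak convergence and convergence on open sets *)

Section portmanteau.
Context {R : realType} {T : completePseudoMetricType R}.
Implicit Types (E G : set T).
Local Notation mT := (measurable : set (set (borelType T))).
Local Open Scope ereal_scope.

Lemma concentrated_setI (pi : probability (borelType T) R) E (S : set T) :
  borel E -> concentrated R E pi -> borel S -> pi (E `&` S) = pi S.
Proof.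
move=> bE piE bS; have mE : mT E by []; have mS : mT S by [].
rewrite -[in RHS](setIT S) -(setvU E) setIUr measureU; last 3 first.
- exact/measurableI/measurableC.
- exact: measurableI.
- by rewrite setIACA setICl setI0.
rewrite setIC [X in X + _](_ : _ = 0) ?add0e//.
apply/eqP; rewrite eq_le measure_ge0 andbT.
have <- : pi (~` E) = 0 by rewrite probability_setC// piE subee.
by apply: le_measure; rewrite ?inE//; [exact/measurableI/measurableC|exact: measurableC].
Qed.

Lemma concentratedS (pi : probability (borelType T) R) E E' : borel E ->
  borel E' -> E `<=` E' -> concentrated R E pi -> concentrated R E' pi.
Proof.
move=> bE bE' EE' piE; apply/eqP; rewrite eq_le probability_le1//=.
by rewrite -piE; apply: le_measure; rewrite ?inE.
Qed.

Lemma open_inner_closed (pi : probability (borelType T) R) G (r : R) : open G ->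
  r%:E < pi G -> exists C : set T, [/\ closed C, C `<=` G & r%:E < pi C].
Proof.
move=> oG rG.
(* Points at depth [1 / n.+1] inside [G]. The closure stays in [G]: a limit point lies in the ball
   of a nearby point of [D n]. *)
pose D n : set T := [set x | ball x (n.+1%:R^-1)%R `<=` G].
pose C n := closure (D n).
have CG n : C n `<=` G.
  move=> x /(_ (ball x (n.+1%:R^-1)%R))[|y [Dy /ball_sym xy]]; last exact: Dy.
  by apply: nbhsx_ballx; rewrite invr_gt0 ltr0Sn.
have GE : \bigcup_n C n = G.
  apply/seteqP; split=> [x [n _]|x Gx]; first exact: CG.
  have := open_nbhs_nbhs (conj oG Gx) => /nbhs_ballP[e /= e0 eG].
  have [n ne] : exists n, (n.+1%:R^-1 < e)%R.
    by have [n] := ltr_add_invr e0; rewrite add0r; exists n.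
  exists n => //; apply: subset_closure => y yx; apply: eG.
  by apply: le_ball yx; exact: ltW.
have Cmono : nondecreasing_seq C.
  move=> m n mn; apply/subsetPset; apply: closureS => x Dx y xy.
  by apply: Dx; apply: le_ball xy; rewrite lef_pV2 ?posrE// ler_nat.
have mC n : mT (C n) by apply: borel_closed; exact: closed_closure.
have := nondecreasing_cvg_mu (mu := pi) mC _ Cmono; rewrite GE => /(_ (borel_open oG)).
move=> /(_ _ (open_ereal_gt' rG))[n _ Hn]; exists (C n); split => //.
  exact: closed_closure.
by apply: (Hn n) => /=.
Qed.

Lemma continuous_measurable (f : T -> R) : continuous f ->
  measurable_fun (setT : set (borelType T)) f.
Proof.
move=> cf; apply/measurable_EFinP; apply: emeasurable_fun_superlevel => r.
apply: borel_open; rewrite (_ : [set t | _] = f @^-1` [set x | (r < x)%R]).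
  by move/continuousP : cf; apply; exact: open_gt.
by apply/seteqP; split=> t /=; rewrite lte_fin.
Qed.

(* Test functions separating a closed set from the complement of an open one. *)
Lemma weakP_open_cvg E (I : Type) (F : set_system I) (FF : Filter F)
    (mu : I -> weakP R E) (pi : weakP R E) : borel E ->
  mu @ F --> pi -> open_cvg F (fun i => weakP_val (mu i)) (weakP_val pi).
Proof.
move=> bE mupi G oG r /(open_inner_closed oG)[C [clC CG rC]].
have mC : mT C by exact: borel_closed.
have mG : mT G by exact: borel_open.
have mE : mT E by exact: bE.
have sep : uniform_separator (~` G) C.
  apply: normal_uniform_separator => //; first exact: pseudometric_normal.
    exact: open_closedC.
  by rewrite -subset0 => t [nGt /CG].
have /(@uniform_separatorP _ R)[f [cf f01 f0 f1]] := sep.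
have {}f01 t : (0 <= f t <= 1)%R by have := f01 (f t); rewrite /= in_itv/=; apply; exists t.
have mf := continuous_measurable cf.
have bf : bounded_continuous E f.
  split; first exact: continuous_subspaceT.
  by exists 1%R => t _; have /andP[? ?] := f01 t; rewrite ger0_norm.
have mfE : measurable_fun (E : set (borelType T)) (EFin \o f).
  by apply/measurable_EFinP; exact: measurable_funTS.
have Hint (nu : probability (borelType T) R) : concentrated R E nu ->
    nu C <= \int[nu]_(t in E) (f t)%:E <= nu G.
  move=> nuE; apply/andP; split.
    rewrite -(concentrated_setI bE nuE mC) setIC -integral_indic//.
    apply: ge0_le_integral => //.
    - by apply/measurable_EFinP; exact: measurable_indic.
    - move=> t _; rewrite lee_fin indicE; have [/set_mem Ct|_] := boolP (t \in C).
        by rewrite (f1 (f t))//; exists t.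
      by case/andP : (f01 t).
  rewrite -(concentrated_setI bE nuE mG) setIC -integral_indic//.
  apply: ge0_le_integral => //.
  - by move=> t _; rewrite lee_fin; case/andP : (f01 t).
  - by apply/measurable_EFinP; exact: measurable_indic.
  - move=> t _; rewrite lee_fin indicE; have [_|/negP Gt] := boolP (t \in G).
      by case/andP : (f01 t).
    by rewrite (f0 (f t))//; exists t => //= ?; apply: Gt; exact: mem_set.
have Hfin (nu : probability (borelType T) R) : concentrated R E nu ->
    \int[nu]_(t in E) (f t)%:E \is a fin_num.
  move=> nuE; have /andP[h1 h2] := Hint _ nuE.
  rewrite ge0_fin_numE; last exact: le_trans h1.
  by apply: le_lt_trans h2 _; rewrite (le_lt_trans (probability_le1 _ _))// ltry.
have rf : (r < \int[weakP_val pi]_(t in E) f t)%R.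
  have /andP[h1 _] := Hint _ (set_valP pi).
  rewrite -lte_fin fineK ?Hfin//; last exact: set_valP.
  exact: lt_le_trans h1.
have /weakP_cvgP/(_ f bf) cvf := mupi.
have Ff : \forall i \near F, (r < \int[weakP_val (mu i)]_(t in E) f t)%R.
  exact: cvgr_gt cvf _ rf.
move: Ff; apply: filterS => i; rewrite -lte_fin fineK; last first.
  by apply: Hfin; exact: set_valP.
by move=> /lt_le_trans; apply; have /andP[] := Hint _ (set_valP (mu i)).
Qed.

Let bounded_continuous_open E (f : T -> R) (l : R) : bounded_continuous E f ->
  exists2 G : set T, open G & E `&` G = E `&` [set t | (l < f t)%R].
Proof.
move=> [/continuousP cf _].
have /open_subspaceP[V oV VE] : open (f @^-1` [set x | (l < x)%R] : set (subspace E)).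
  by apply: cf; exact: open_gt.
by exists V => //; rewrite setIC VE setIC.
Qed.

Let bounded_continuous_measurable E (f : T -> R) : borel E ->
  bounded_continuous E f -> measurable_fun (E : set (borelType T)) f.
Proof.
move=> bE bf; apply/measurable_EFinP/(measurable_restrictT _ _).2 => //.
apply: emeasurable_fun_superlevel => l.
have [G oG GE] := bounded_continuous_open l bf.
have mEG : mT (E `&` G) by apply: measurableI => //; exact: borel_open.
have H t : E t -> (l%:E < ((EFin \o f) \_ E) t) = (l < f t)%R.
  by move=> Et; rewrite patchE mem_set// lte_fin.
have H' t : ~ E t -> (l%:E < ((EFin \o f) \_ E) t) = (l < 0)%R.
  by move=> Et; rewrite patchE memNset// lte_fin.
have [l0|l0] := ltP l 0%R.
  rewrite (_ : [set t | _] = (E `&` G) `|` ~` E).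
    by apply: measurableU => //; exact: measurableC.
  rewrite GE; apply/seteqP; split=> t /=.
    by have [Et|Et] := pselect (E t); [rewrite H//; left|right].
  by move=> [[Et]|Et]; [rewrite H|rewrite H'].
rewrite (_ : [set t | _] = E `&` G)// GE; apply/seteqP; split=> t /=.
  have [Et|Et] := pselect (E t); first by rewrite H.
  by rewrite H'// ltNge l0.
by move=> [Et]; rewrite H.
Qed.

Let bounded_continuous_integrable E (f : T -> R) (nu : probability (borelType T) R) :
  borel E -> bounded_continuous E f ->
  nu.-integrable (E : set (borelType T)) (EFin \o f).
Proof.
move=> bE bf; apply: measurable_bounded_integrable => //.
- by rewrite (le_lt_trans (probability_le1 _ _))// ltry.
- exact: bounded_continuous_measurable.
have [_ [M fM]] := bf; exists M; split; first exact: num_real.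
by move=> x Mx t Et; apply: le_trans (fM _ Et) _; exact: ltW.
Qed.

(** A bounded continuous function on [E], shifted to be nonnegative and extended by 0, has
    superlevel sets with the same measure as open sets, so [integral_lsc] bounds its integrals from
    below. Applying this to [f] and to [- f] gives convergence. *)
Lemma open_cvg_weakP E (I : Type) (F : set_system I) (FF : Filter F)
    (mu : I -> weakP R E) (pi : weakP R E) : borel E ->
  open_cvg F (fun i => weakP_val (mu i)) (weakP_val pi) -> mu @ F --> pi.
Proof.
move=> bE mupi; apply/weakP_cvgP => f bf.
have conc (nu : weakP R E) : concentrated R E (weakP_val nu) := set_valP nu.
have key (g : T -> R) (a : R) : bounded_continuous E g ->
    (a < \int[weakP_val pi]_(t in E) g t)%R ->
    \forall i \near F, (a < \int[weakP_val (mu i)]_(t in E) g t)%R.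
  move=> bg ag; have [_ [M gM]] := bg.
  have bgM : bounded_continuous E (fun t => g t + M)%R.
    split; last first.
      exists (M + `|M|)%R => t Et; apply: le_trans (ler_normD _ _) _.
      by rewrite lerD2r gM.
    by case: bg => cg _ t; apply: cvgD; [exact: cg|exact: cvg_cst].
  pose h := (EFin \o (fun t => g t + M)%R) \_ E.
  have mh : measurable_fun (setT : set (borelType T)) h.
    apply/(measurable_restrictT _ _).1 => //; apply/measurable_EFinP.
    exact: bounded_continuous_measurable.
  have h0 t : 0 <= h t.
    rewrite /h patchE; case: ifPn => // /set_mem Et; rewrite lee_fin.
    by have := gM t Et; rewrite ler_norml => /andP[+ _]; rewrite -lerBlDr sub0r.
  have hint (nu : weakP R E) : \int[weakP_val nu]_t h t =
      (\int[weakP_val nu]_(t in E) g t + M)%:E.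
    rewrite /h -integral_mkcond.
    have -> : (\int[weakP_val nu]_(t in E) g t + M =
        \int[weakP_val nu]_(t in E) (g t + M))%R.
      rewrite RintegralD//.
      - by rewrite Rintegral_cst//= conc/= mulr1.
      - exact: bounded_continuous_integrable.
      - apply: (@bounded_continuous_integrable E (cst M)) => //; split.
          by move=> t; exact: cvg_cst.
        by exists `|M|%R.
    rewrite fineK//; apply: integrable_fin_num => //.
    exact: bounded_continuous_integrable.
  have hG l : exists2 G : set T, open G &
      forall nu : weakP R E, weakP_val nu [set t | l%:E < h t] = weakP_val nu G.
    have [G oG GE] := bounded_continuous_open l bgM; exists G => // nu.
    have mhl : mT [set t | l%:E < h t] by exact: superlevel_measurable.
    rewrite -(concentrated_setI bE (conc nu) mhl).
    rewrite -[RHS](concentrated_setI bE (conc nu) (borel_open oG)).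
    rewrite GE; congr (weakP_val nu _); apply/seteqP; split=> t [Et] /=.
      by rewrite /h patchE mem_set// lte_fin.
    by move=> ltg; split => //; rewrite /h patchE mem_set// lte_fin.
  suff : \forall i \near F, (a + M)%:E < \int[weakP_val (mu i)]_t h t.
    by apply: filterS => i; rewrite hint lte_fin ltrD2r.
  apply: (integral_lsc (pi := weakP_val pi) (h := h)) => //.
  - by apply: nearW.
  - move=> l r; have [G oG GE] := hG l; rewrite GE => /(mupi G oG).
    by apply: filterS => i; rewrite GE.
  - by rewrite hint lte_fin ltrD2r.
apply/cvgrPdist_lt => e e0.
have bfN : bounded_continuous E (fun t => - f t)%R.
  case: bf => cf [M fM]; split; last by exists M => t Et; rewrite normrN fM.
  by move=> t; apply: cvgN; exact: cf.
have RN (nu : weakP R E) :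
    (\int[weakP_val nu]_(t in E) - f t = - \int[weakP_val nu]_(t in E) f t)%R.
  rewrite -mulN1r -RintegralZl//; last exact: bounded_continuous_integrable.
  by congr fine; apply: eq_integral => t _; rewrite mulN1r.
have lo := key f (\int[weakP_val pi]_(t in E) f t - e)%R bf.
have hi := key _ (\int[weakP_val pi]_(t in E) (- f t) - e)%R bfN.
near=> i; rewrite ltr_norml.
have : (\int[weakP_val pi]_(t in E) f t - e < \int[weakP_val (mu i)]_(t in E) f t)%R.
  by near: i; apply: lo; rewrite ltrBlDr ltrDl.
have : (\int[weakP_val pi]_(t in E) - f t - e < \int[weakP_val (mu i)]_(t in E) - f t)%R.
  by near: i; apply: hi; rewrite ltrBlDr ltrDl.
rewrite !RN; lra.
Unshelve. all: by end_near. Qed.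

(** The constant family [nu] converges to [mu], hence [nu] lies in every neighbourhood of [mu]. *)
Lemma weakP_indistinguishable E (mu nu : weakP R E) : borel E ->
  (forall G, open G -> weakP_val mu G = weakP_val nu G) ->
  forall W : set (weakP R E), open W -> W mu -> W nu.
Proof.
move=> bE munu W oW Wmu.
have : (fun=> nu) @ (principal_filter tt) --> mu.
  apply: open_cvg_weakP => // G oG r; rewrite munu// => rG.
  exact: nearW.
by move=> /(_ W (open_nbhs_nbhs (conj oW Wmu))) /= /principal_filterP.
Qed.

End portmanteau.

(** * A single game *)

Section mixture.
Context {R : realType} {d : measure_display} {T : measurableType d}.
Variables (t : R) (mu nu : probability T R).
Hypothesis t01 : 0 <= t <= 1.
Local Open Scope ereal_scope.

Let t0 : (0 <= t)%R. Proof. by case/andP : t01. Qed.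
Let s0 : (0 <= 1 - t)%R. Proof. by rewrite subr_ge0; case/andP : t01. Qed.

Let mix : {measure set T -> \bar R} :=
  measure_add (mscale (NngNum t0) mu) (mscale (NngNum s0) nu).

Let mixE A : mix A = t%:E * mu A + (1 - t)%:E * nu A.
Proof. by rewrite [LHS]measure_addE. Qed.

Lemma mixture_exists : exists rho : probability T R,
  forall A, rho A = t%:E * mu A + (1 - t)%:E * nu A.
Proof.
have mix1 : mix setT = 1.
  by rewrite mixE !probability_setT !mule1 -EFinD addrC subrK.
pose p := Measure_isProbability.Build _ _ _ mix mix1.
pose rho : probability T R := HB.pack (Measure.sort mix) p.
by exists rho.
Qed.

Lemma integral_mixture (rho : probability T R) (D : set T) (f : T -> \bar R) :
  (forall A, measurable A -> rho A = t%:E * mu A + (1 - t)%:E * nu A) ->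
  measurable D -> measurable_fun D f -> (forall x, D x -> 0 <= f x) ->
  \int[rho]_(x in D) f x = t%:E * \int[mu]_(x in D) f x + (1 - t)%:E * \int[nu]_(x in D) f x.
Proof.
move=> rhoE mD mf f0; rewrite (eq_measure_integral mix); last first.
  by move=> A mA _; rewrite mixE; exact: rhoE.
by rewrite ge0_integral_measure_add// !ge0_integral_mscale.
Qed.

End mixture.

(** * Countable bases and Borel sets of products *)

Lemma polish_countable_base (R : realType) (T : completePseudoMetricType R) :
  polish T -> exists2 W : nat -> set T, (forall i, open (W i)) &
    forall (G : set T) x, open G -> G x -> exists i, W i x /\ W i `<=` G.
Proof.
move=> [hT [D cD dD]].
have /countable_injP[f finj] := cD.
have [dn dnP] : exists dn : nat -> T, forall d, D d -> dn (f d) = d.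
  exists (fun n => xget point [set d | D d /\ f d = n]) => d Dd.
  case: xgetP => [e _ [De fe]|/(_ d)[]//].
  by apply: finj => //; rewrite inE.
(* Balls of a pseudometric structure need not be open, hence the interiors; below, the centre is
   taken within half the radius of [x] so that [x] is an interior point. *)
pose W i := if @choice.unpickle (nat * nat)%type i is Some (n, k)
  then (ball (dn n) (k.+1%:R^-1))° else set0.
exists W => [i|G x oG Gx]; rewrite /W.
  by case: choice.unpickle => [[n k]|]; [exact: open_interior|exact: open0].
have /nbhs_ballP[e /= e0 eG] := open_nbhs_nbhs (conj oG Gx).
have e20 : 0 < e / 2 by rewrite divr_gt0.
have [k] := ltr_add_invr e20; rewrite add0r => ke.
have k0 : 0 < k.+1%:R^-1 :> R by rewrite invr_gt0 ltr0Sn.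
have k20 : 0 < k.+1%:R^-1 / 2 :> R by rewrite divr_gt0.
have [|d [/interior_subset xd Dd]] := dD (ball x (k.+1%:R^-1 / 2))° _ (open_interior _).
  by exists x; exact: nbhsx_ballx.
exists (choice.pickle (f d, k)); rewrite choice.pickleK dnP//; split.
  apply/nbhs_ballP; exists (k.+1%:R^-1 / 2) => // y xy.
  by rewrite [k.+1%:R^-1]splitr; apply: ball_triangle xy; exact: ball_sym.
move=> y /interior_subset dy; apply: eG; rewrite [e]splitr.
apply: (@ball_triangle _ _ d); last by apply: le_ball dy; exact: ltW.
apply: le_ball xd; apply: (@le_trans _ _ k.+1%:R^-1); last exact: ltW.
by rewrite ler_pdivrMr// ler_pMr// ler1n.
Qed.

(** By countable bases, an open set of the product is a countable union of open rectangles. This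
    links the Borel measurability in [zero_sum_game] with the product sigma-algebra on which
    Tonelli's theorem operates. *)
Lemma borel_prod_measurable (R : realType) (T U : completePseudoMetricType R)
    (S : set (T * U)) : polish T -> polish U -> borel S ->
  measurable (S : set (borelType T * borelType U)).
Proof.
move=> /polish_countable_base[V oV bV] /polish_countable_base[W oW bW].
apply: smallest_sub; first exact: sigma_algebra_measurable.
move=> O oO.
rewrite (_ : O = \bigcup_i \bigcup_j
    (if `[< V i `*` W j `<=` O >] then V i `*` W j else set0)); last first.
  apply/seteqP; split=> [[x y] Oxy|z [i _ [j _]]]; last by case: asboolP => // /[apply].
  have [[P Q] /= [Px Qy] PQO] := open_nbhs_nbhs (conj oO Oxy).
  have [i [Vx VP]] := bV P° x (open_interior _) Px.
  have [j [Wy WQ]] := bW Q° y (open_interior _) Qy.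
  exists i => //; exists j => //; rewrite asboolT// => z [/VP/interior_subset z1].
  by move=> /WQ/interior_subset z2; exact: PQO.
apply: bigcupT_measurable => i; apply: bigcupT_measurable => j.
case: asboolP => // _; apply: measurableX.
- exact: borel_open.
- exact: borel_open.
Qed.

Lemma borel_xsection (T U : topologicalType) (K : set (T * U)) (x : T) :
  borel K -> borel (xsection K x).
Proof.
move=> bK; rewrite (_ : xsection K x = (fun y => (x, y)) @^-1` K); last first.
  by apply/seteqP; split=> y /xsectionP.
apply: continuous_borel_fun bK => y; apply: cvg_pair => //=; exact: cvg_cst.
Qed.

Section one_game.
Context {R : realType} {TA TB : completePseudoMetricType R}.
Variables (Ax : set TA) (Bx : set TB) (g : TA -> TB -> R).
Hypotheses (polA : polish TA) (polB : polish TB) (bA : borel Ax) (bB : borel Bx).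
Local Open Scope ereal_scope.
Local Notation mA := (measurable : set (set (borelType TA))).
Local Notation mB := (measurable : set (set (borelType TB))).

Definition jointly_measurable (f : TA -> TB -> R) :=
  measurable_fun (Ax `*` Bx : set (borelType (TA * TB)%type)) (fun z => f z.1 z.2).

Lemma jointly_measurable_comp (f : TA -> TB -> R) (h : R -> R) :
  measurable_fun setT h -> jointly_measurable f ->
  jointly_measurable (fun a b => h (f a b)).
Proof. by move=> mh mf; exact: (measurableT_comp mh mf). Qed.

Let mAB : measurable (Ax `*` Bx : set (borelType (TA * TB)%type)).
Proof.
rewrite (_ : _ `*` _ = (fst @^-1` Ax) `&` (snd @^-1` Bx))//.
apply: measurableI.
- apply: continuous_borel_fun bA; by move=> z; exact: cvg_fst.
- apply: continuous_borel_fun bB; by move=> z; exact: cvg_snd.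
Qed.

Lemma measurable_fun_left (f : TA -> TB -> R) b : jointly_measurable f -> Bx b ->
  measurable_fun (Ax : set (borelType TA)) (f^~ b).
Proof.
move=> mf Bb.
have mpair : measurable_fun (Ax : set (borelType TA))
    ((fun a => (a, b)) : borelType TA -> borelType (TA * TB)%type).
  move=> _ Y bY; apply: measurableI => //.
  have : borel_fun (fun a : TA => (a, b)); last exact.
  by apply: continuous_borel_fun => a; apply: cvg_pair => //=; exact: cvg_cst.
apply: (measurable_comp mAB _ mf mpair).
by move=> _ [a Aa <-].
Qed.

Lemma measurable_fun_right (f : TA -> TB -> R) a : jointly_measurable f -> Ax a ->
  measurable_fun (Bx : set (borelType TB)) (f a).
Proof.
move=> mf Aa.
have mpair : measurable_fun (Bx : set (borelType TB))
    ((fun b => (a, b)) : borelType TB -> borelType (TA * TB)%type).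
  move=> _ Y bY; apply: measurableI => //.
  have : borel_fun (fun b : TB => (a, b)); last exact.
  by apply: continuous_borel_fun => b; apply: cvg_pair => //=; exact: cvg_cst.
apply: (measurable_comp mAB _ mf mpair).
by move=> _ [b Bb <-].
Qed.

Section tonelli.
Variable f : TA -> TB -> R.
Hypotheses (mf : jointly_measurable f) (f0 : forall a b, (0 <= f a b)%R).
Variables (piA : probability (borelType TA) R) (piB : probability (borelType TB) R).

Let F : borelType TA * borelType TB -> \bar R :=
  (EFin \o (fun z => f z.1 z.2)) \_ (Ax `*` Bx).

Let mF : measurable_fun setT F.
Proof.
apply/(measurable_restrictT _ _).1; first exact: measurableX.
apply/measurable_EFinP => _ Y mY; apply: borel_prod_measurable => //.
exact: (mf mAB mY).
Qed.

Let F0 z : 0 <= F z.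
Proof. by rewrite /F patchE; case: ifP => //= _; rewrite lee_fin. Qed.

Let FA a : Ax a -> \int[piB]_(b in Bx) (f a b)%:E = \int[piB]_b F (a, b).
Proof.
move=> Aa; rewrite integral_mkcond; apply: eq_integral => b _.
rewrite /F !patchE; have [Bb|nBb] := pselect (Bx b).
  by rewrite !mem_set.
by rewrite !memNset// => -[].
Qed.

Let FA' a : ~ Ax a -> \int[piB]_b F (a, b) = 0.
Proof.
by move=> nAa; rewrite integral0_eq// => b _; rewrite /F patchE memNset// => -[].
Qed.

Let FB b : Bx b -> \int[piA]_(a in Ax) (f a b)%:E = \int[piA]_a F (a, b).
Proof.
move=> Bb; rewrite integral_mkcond; apply: eq_integral => a _.
rewrite /F !patchE; have [Aa|nAa] := pselect (Ax a).
  by rewrite !mem_set.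
by rewrite !memNset// => -[].
Qed.

Let FB' b : ~ Bx b -> \int[piA]_a F (a, b) = 0.
Proof.
by move=> nBb; rewrite integral0_eq// => a _; rewrite /F patchE memNset// => -[].
Qed.

Lemma measurable_integral_right :
  measurable_fun (Ax : set (borelType TA)) (fun a => \int[piB]_(b in Bx) (f a b)%:E).
Proof.
apply: (eq_measurable_fun (fubini_F piB F)).
  by move=> a /set_mem Aa; rewrite /fubini_F FA.
exact/measurable_funTS/measurable_fun_fubini_tonelli_F.
Qed.

Lemma measurable_integral_left :
  measurable_fun (Bx : set (borelType TB)) (fun b => \int[piA]_(a in Ax) (f a b)%:E).
Proof.
apply: (eq_measurable_fun (fubini_G piA F)).
  by move=> b /set_mem Bb; rewrite /fubini_G FB.
exact/measurable_funTS/measurable_fun_fubini_tonelli_G.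
Qed.

Lemma tonelli_rectangle :
  \int[piA]_(a in Ax) \int[piB]_(b in Bx) (f a b)%:E =
  \int[piB]_(b in Bx) \int[piA]_(a in Ax) (f a b)%:E.
Proof.
rewrite [LHS]integral_mkcond [RHS]integral_mkcond.
transitivity (\int[piA]_a \int[piB]_b F (a, b)).
  apply: eq_integral => a _; rewrite patchE; case: ifPn => [/set_mem/FA//|/negP na].
  by rewrite FA'// => Aa; apply: na; exact: mem_set.
rewrite fubini_tonelli//; apply: eq_integral => b _.
rewrite patchE; case: ifPn => [/set_mem/FB//|/negP nb].
by rewrite FB'// => Bb; apply: nb; exact: mem_set.
Qed.

End tonelli.

Hypothesis game : zero_sum_game Ax Bx g.

Let gp a b := Num.max (g a b) 0%R.
(** The opposite of the negative part used in [payoff_neg], so that all integrals are of nonnegative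
    functions. *)
Let gn a b := Num.max (- g a b)%R 0%R.

Let mbA : mA Ax := bA.
Let mbB : mB Bx := bB.

Let mg : jointly_measurable g. Proof. by case: game. Qed.

Let mgp : jointly_measurable gp.
Proof.
apply: (@jointly_measurable_comp g (fun x => Num.max x 0%R)) => //.
by apply: measurable_maxr => //; exact: measurable_cst.
Qed.

Let mgn : jointly_measurable gn.
Proof.
apply: (@jointly_measurable_comp g (fun x => Num.max (- x)%R 0%R)) => //.
by apply: measurable_maxr => //; exact: measurable_cst.
Qed.

Let gp0 a b : (0 <= gp a b)%R. Proof. by rewrite /gp le_max lexx orbT. Qed.
Let gn0 a b : (0 <= gn a b)%R. Proof. by rewrite /gn le_max lexx orbT. Qed.

Let gpn a b : (g a b = gp a b - gn a b)%R.
Proof. by rewrite /gp /gn; case: leP => ?; case: leP => ?; lra. Qed.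

Implicit Types (piA : probability (borelType TA) R) (piB : probability (borelType TB) R).

Let P piA piB := \int[piA]_(a in Ax) \int[piB]_(b in Bx) (gp a b)%:E.
Let N piA piB := \int[piA]_(a in Ax) \int[piB]_(b in Bx) (gn a b)%:E.

Let inner_ge0 (f : TA -> TB -> R) piB a : (forall a b, (0 <= f a b)%R) ->
  0 <= \int[piB]_(b in Bx) (f a b)%:E.
Proof. by move=> f0; apply: integral_ge0 => b _; rewrite lee_fin. Qed.

Let inner_ge0' (f : TA -> TB -> R) piA b : (forall a b, (0 <= f a b)%R) ->
  0 <= \int[piA]_(a in Ax) (f a b)%:E.
Proof. by move=> f0; apply: integral_ge0 => a _; rewrite lee_fin. Qed.

Lemma payoff_negE piA piB : payoff_neg Ax Bx g piA piB = - N piA piB.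
Proof.
rewrite /payoff_neg /N -integral_ge0N; last by move=> a _; exact: inner_ge0.
apply: eq_integral => a _; rewrite -integral_ge0N; last by move=> b _; rewrite lee_fin.
by apply: eq_integral => b _; rewrite -EFinN oppr_max opprK oppr0.
Qed.

Lemma payoffE piA piB : payoff Ax Bx g piA piB = P piA piB - N piA piB.
Proof. by rewrite /payoff payoff_negE. Qed.

Let inner_dirac (f : TA -> TB -> R) a b : jointly_measurable f -> Ax a -> Bx b ->
  \int[\d_(b : borelType TB)]_(b' in Bx) (f a b')%:E = (f a b)%:E.
Proof.
move=> mf Aa Bb; rewrite (integral_dirac _ mbB); last first.
  by apply/measurable_EFinP; exact: measurable_fun_right.
by rewrite /= diracE mem_set// mul1e.
Qed.

Lemma payoff_diracr piA b : Bx b -> payoff Ax Bx g piA \d_(b : borelType TB) =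
  \int[piA]_(a in Ax) (gp a b)%:E - \int[piA]_(a in Ax) (gn a b)%:E.
Proof.
move=> Bb; rewrite payoffE; congr (_ - _); apply: eq_integral => a /set_mem Aa.
  exact: inner_dirac.
exact: inner_dirac.
Qed.

Lemma payoff_diracl piB a : Ax a -> payoff Ax Bx g \d_(a : borelType TA) piB =
  \int[piB]_(b in Bx) (gp a b)%:E - \int[piB]_(b in Bx) (gn a b)%:E.
Proof.
move=> Aa; rewrite payoffE /P /N; congr (_ - _).
  rewrite (integral_dirac _ mbA); last exact: measurable_integral_right.
  by rewrite /= diracE mem_set// mul1e.
rewrite (integral_dirac _ mbA); last exact: measurable_integral_right.
by rewrite /= diracE mem_set// mul1e.
Qed.

Lemma payoff_dirac a b : Ax a -> Bx b ->
  payoff Ax Bx g \d_(a : borelType TA) \d_(b : borelType TB) = (g a b)%:E.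
Proof. by move=> Aa Bb; rewrite payoff_diracl// !inner_dirac// -EFinB -gpn. Qed.

Let integral_bounded (d : measure_display) (T : measurableType d)
    (mu : probability T R) (D : set T) (f : T -> R) (M : R) : measurable D ->
  measurable_fun D f -> (forall t, (0 <= f t)%R) -> (forall t, D t -> (f t <= M)%R) ->
  \int[mu]_(t in D) (f t)%:E <= `|M|%:E.
Proof.
move=> mD mf f0 fM.
apply: (@le_trans _ _ (\int[mu]_(t in D) (cst `|M|%:E) t)).
  apply: ge0_le_integral => //.
  - by move=> t _; rewrite lee_fin.
  - exact/measurable_EFinP.
  - by move=> t Dt; rewrite lee_fin; apply: le_trans (fM t Dt) _; exact: ler_norm.
rewrite integral_cst// -[leRHS]mule1; apply: lee_pmul => //.
exact: probability_le1.
Qed.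

(** The lower bound of the game in [a] makes the payoff against a pure [b] well defined for every
    [piA]; [gp_fin] is the mirror statement for a pure [a]. *)
Let gn_fin piA b : Bx b -> \int[piA]_(a in Ax) (gn a b)%:E \is a fin_num.
Proof.
move=> Bb; have [_ /(_ b Bb)[m hm] _] := game.
rewrite ge0_fin_numE ?inner_ge0'//; apply: le_lt_trans (ltry `|Num.max (- m)%R 0%R|).
apply: integral_bounded => //; first exact: measurable_fun_left.
move=> a Aa; rewrite ge_max le_max; apply/andP; split; last by rewrite le_max lexx orbT.
by rewrite lerN2 hm//; exists a.
Qed.

Let gp_fin piB a : Ax a -> \int[piB]_(b in Bx) (gp a b)%:E \is a fin_num.
Proof.
move=> Aa; have [_ _ /(_ a Aa)[m hm]] := game.
rewrite ge0_fin_numE ?inner_ge0//; apply: le_lt_trans (ltry `|Num.max m 0%R|).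
apply: integral_bounded => //; first exact: measurable_fun_right.
move=> b Bb; rewrite ge_max le_max; apply/andP; split; last by rewrite le_max lexx orbT.
by rewrite hm//; exists b.
Qed.

(** Trades the difference of two integrals for a single integral of a nonnegative function, to which
    [integral_lsc] and Markov's inequality apply. *)
Lemma payoff_shift piA b (m : R) : concentrated R Ax piA -> Bx b -> (0 <= m)%R ->
  (forall a, Ax a -> (- m <= g a b)%R) ->
  \int[piA]_(a in Ax) (g a b + m)%:E = payoff Ax Bx g piA \d_(b : borelType TB) + m%:E.
Proof.
move=> piAx Bb m0 hm; rewrite payoff_diracr//.
have mgb := measurable_fun_left mg Bb.
have mgpb := measurable_fun_left mgp Bb.
have mgnb := measurable_fun_left mgn Bb.
have gm0 a : Ax a -> 0 <= (g a b + m)%:E.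
  by move=> Aa; rewrite lee_fin -lerBlDr sub0r hm.
have : \int[piA]_(a in Ax) (g a b + m)%:E + \int[piA]_(a in Ax) (gn a b)%:E =
    \int[piA]_(a in Ax) (gp a b)%:E + m%:E.
  rewrite -[m%:E in RHS]mule1 -[in RHS]piAx -(integral_cst piA mbA).
  rewrite -ge0_integralD//.
  - rewrite -ge0_integralD//; last 2 first.
    + by move=> a _; rewrite lee_fin.
    + by apply/measurable_EFinP.
    apply: eq_integral => a _; rewrite -!EFinD; congr EFin.
    by rewrite [in LHS]gpn; lra.
  - by apply/measurable_EFinP; apply: measurable_funD.
  - by move=> a _; rewrite lee_fin.
  - by apply/measurable_EFinP.
move/(congr1 (fun x => x - \int[piA]_(a in Ax) (gn a b)%:E)).
by rewrite addeK ?gn_fin// => ->; rewrite addeAC.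
Qed.

Let integral_le_add (d : measure_display) (T : measurableType d)
    (mu : probability T R) (D : set T) (f h : T -> \bar R) (r s : R) : measurable D ->
  mu D = 1 -> measurable_fun D f -> (forall t, D t -> 0 <= f t) ->
  measurable_fun D h -> (forall t, D t -> 0 <= h t) -> (0 <= r)%R -> (0 <= s)%R ->
  (forall t, D t -> f t + r%:E <= h t + s%:E) ->
  \int[mu]_(t in D) f t + r%:E <= \int[mu]_(t in D) h t + s%:E.
Proof.
move=> mD muD mf f0 mh h0 r0 s0 fh.
have E k x : measurable_fun D k -> (forall t, D t -> 0 <= k t) -> (0 <= x)%R ->
    \int[mu]_(t in D) (k t + x%:E) = \int[mu]_(t in D) k t + x%:E.
  by move=> mk k0 x0; rewrite ge0_integralD// integral_cst//= muD mule1.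
rewrite -!E//; apply: ge0_le_integral => //.
- by move=> t Dt; rewrite adde_ge0 ?f0.
- exact: emeasurable_funD.
- exact: emeasurable_funD.
Qed.

Let sub_le (p n rp rn sp sn : R) :
  (n + rp <= p + rn -> p + sn <= n + sp -> rp - rn <= sp - sn)%R.
Proof. by move=> *; lra. Qed.

(* Integrating [r <= F a] and [G b <= s], after moving the negative parts to
   the other side so that only nonnegative functions occur. *)
Lemma payoff_weak_duality piA piB : concentrated R Ax piA ->
  concentrated R Bx piB -> payoff_defined Ax Bx g piA piB ->
  payoff_flat Ax Bx g piB <= payoff_sharp Ax Bx g piA.
Proof.
move=> piAx piBx def; rewrite leNgt; apply/negP => lt.
have [r [s [sr rflat sharps]]] : exists r s : R, [/\ (s < r)%R,
    r%:E <= payoff_flat Ax Bx g piB & payoff_sharp Ax Bx g piA <= s%:E].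
  move: lt; case: (payoff_flat Ax Bx g piB) => [x| |];
    case: (payoff_sharp Ax Bx g piA) => [y| |] //; rewrite ?lte_fin => yx.
  - by exists x, y; rewrite !lexx.
  - by exists x, (x - 1)%R; split; rewrite ?lexx ?leNye//; lra.
  - by exists (y + 1)%R, y; split; rewrite ?lexx ?leey//; lra.
  - by exists 1%R, 0%R; split; rewrite ?leey ?leNye//; exact: ltr01.
pose rp := Num.max r 0%R; pose rn := Num.max (- r)%R 0%R.
pose sp := Num.max s 0%R; pose sn := Num.max (- s)%R 0%R.
have [rp0 rn0] : (0 <= rp)%R /\ (0 <= rn)%R by rewrite !le_max !lexx !orbT.
have [sp0 sn0] : (0 <= sp)%R /\ (0 <= sn)%R by rewrite !le_max !lexx !orbT.
have rE : (r = rp - rn)%R by rewrite /rp /rn; case: leP => ?; case: leP => ?; lra.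
have sE : (s = sp - sn)%R by rewrite /sp /sn; case: leP => ?; case: leP => ?; lra.
have le1 a : Ax a -> \int[piB]_(b in Bx) (gn a b)%:E + rp%:E <=
    \int[piB]_(b in Bx) (gp a b)%:E + rn%:E.
  move=> Aa; have : r%:E <= payoff Ax Bx g \d_(a : borelType TA) piB.
    by apply: le_trans rflat _; apply: ereal_inf_lbound; exists a.
  rewrite payoff_diracl// -(fineK (gp_fin piB Aa)).
  have := inner_ge0 piB a gn0; case: (\int[piB]_(b in Bx) (gn a b)%:E) => [x| |]//.
  by rewrite -EFinB !lee_fin rE => _; lra.
have le2 b : Bx b -> \int[piA]_(a in Ax) (gp a b)%:E + sn%:E <=
    \int[piA]_(a in Ax) (gn a b)%:E + sp%:E.
  move=> Bb; have : payoff Ax Bx g piA \d_(b : borelType TB) <= s%:E.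
    by apply: le_trans sharps; apply: ereal_sup_ubound; exists b.
  rewrite payoff_diracr// -(fineK (gn_fin piA Bb)).
  have := inner_ge0' piA b gp0; case: (\int[piA]_(a in Ax) (gp a b)%:E) => [x| |]//.
  by rewrite -EFinB !lee_fin sE => _; lra.
have mI f mf f0 := @measurable_integral_right f mf f0 piB.
have mJ f mf f0 := @measurable_integral_left f mf f0 piA.
have H1 : N piA piB + rp%:E <= P piA piB + rn%:E.
  apply: integral_le_add => //; [exact: (mI _ _ _)| |exact: (mI _ _ _)|];
    by move=> a _; exact: inner_ge0.
have H2 : P piA piB + sn%:E <= N piA piB + sp%:E.
  have -> : P piA piB = \int[piB]_(b in Bx) \int[piA]_(a in Ax) (gp a b)%:E.
    exact: tonelli_rectangle.
  have -> : N piA piB = \int[piB]_(b in Bx) \int[piA]_(a in Ax) (gn a b)%:E.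
    exact: tonelli_rectangle.
  apply: integral_le_add => //; [exact: (mJ _ _ _)| |exact: (mJ _ _ _)|];
    by move=> b _; exact: inner_ge0'.
have P0 : 0 <= P piA piB by apply: integral_ge0 => a _; exact: inner_ge0.
have N0 : 0 <= N piA piB by apply: integral_ge0 => a _; exact: inner_ge0.
(* When exactly one of [P] and [N] is infinite, [H1] or [H2] fails; the case of both infinite is the
   one excluded by [payoff_defined]. *)
have {}def : P piA piB \is a fin_num \/ N piA piB \is a fin_num.
  by move: def; rewrite /payoff_defined payoff_negE fin_numN.
move: P0 N0 H1 H2 def; case: (P piA piB) => [p| |]//; case: (N piA piB) => [n| |]//=.
  rewrite -!EFinD !lee_fin => _ _ H1 H2 _.
  by have := sub_le H1 H2; rewrite -rE -sE leNgt sr.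
by move=> _ _ _ _ [].
Qed.

(** On these measures the payoff against each pure [b] is real: the positive part by definition, the
    negative part by [gn_fin]. *)
Let finite_payoffs : set (probability (borelType TA) R) :=
  [set pi | concentrated R Ax pi /\
    forall b, Bx b -> \int[pi]_(a in Ax) (gp a b)%:E \is a fin_num].

Let is_mixture (d : measure_display) (T : measurableType d) (t : R)
    (mu nu rho : probability T R) :=
  forall A, measurable A -> rho A = t%:E * mu A + (1 - t)%:E * nu A.

(** Encodes a mixed strategy [piB] by its payoff function minus [l]. The identity is required only
    at pure [a], which is all that [payoff_flat] evaluates; the bound [M], uniform in [a], later
    makes [piB] safe; affinity on [finite_payoffs] supplies the convexity of the domain. *)
Let realized (l : R) : set (probability (borelType TA) R -> R) :=
  [set phi : probability (borelType TA) R -> R |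
    (exists piB : probability (borelType TB) R, [/\ concentrated R Bx piB,
      exists M : R, forall a, Ax a -> \int[piB]_(b in Bx) (gn a b)%:E <= M%:E &
      forall a, Ax a -> payoff Ax Bx g \d_(a : borelType TA) piB =
        (phi \d_(a : borelType TA) + l)%:E]) /\
    forall (t : R) mu nu rho, (0 <= t <= 1)%R -> finite_payoffs mu ->
      finite_payoffs nu -> is_mixture t mu nu rho ->
      (phi rho = t * phi mu + (1 - t) * phi nu)%R].

Let mixture_fin (t : R) (x y : \bar R) : x \is a fin_num -> y \is a fin_num ->
  t%:E * x + (1 - t)%:E * y = (t * fine x + (1 - t) * fine y)%:E.
Proof. by move=> xf yf; rewrite -{1}(fineK xf) -{1}(fineK yf) -!EFinM -EFinD. Qed.

Let realized_convex (l t : R) (f h : probability (borelType TA) R -> R) :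
  (0 <= t <= 1)%R -> realized l f -> realized l h ->
  realized l (fun s => (t * f s + (1 - t) * h s)%R).
Proof.
move=> t01 [[piB [Bf [M1 M1P] fE]] faff] [[piB' [Bh [M2 M2P] hE]] haff]; split; last first.
  move=> u mu nu rho u01 Smu Snu mix.
  by rewrite (faff u mu nu rho)// (haff u mu nu rho)//; ring.
have [rho rhoE] := mixture_exists piB piB' t01.
have gnfin (pi : probability (borelType TB) R) (M : R) a :
    \int[pi]_(b in Bx) (gn a b)%:E <= M%:E ->
    \int[pi]_(b in Bx) (gn a b)%:E \is a fin_num.
  by move=> le; rewrite ge0_fin_numE ?inner_ge0//; exact: le_lt_trans le (ltry _).
have mixI (f' : TA -> TB -> R) a : jointly_measurable f' ->
    (forall a b, (0 <= f' a b)%R) -> Ax a ->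
    \int[rho]_(b in Bx) (f' a b)%:E = t%:E * \int[piB]_(b in Bx) (f' a b)%:E +
      (1 - t)%:E * \int[piB']_(b in Bx) (f' a b)%:E.
  move=> mf' f'0 Aa; apply: integral_mixture => //.
  - by apply/measurable_EFinP; exact: measurable_fun_right.
  - by move=> b _; rewrite lee_fin.
exists rho; split.
- rewrite /concentrated/= rhoE Bf Bh !mule1 -EFinD; congr EFin; ring.
- exists (t * M1 + (1 - t) * M2)%R => a Aa; rewrite mixI// [leRHS]EFinD !EFinM.
  have /andP[t0 t1] := t01.
  apply: leeD; apply: lee_wpmul2l; rewrite ?lee_fin ?subr_ge0//.
    exact: M1P.
  exact: M2P.
- move=> a Aa; rewrite payoff_diracl// !mixI//.
  have gf1 := gnfin _ _ _ (M1P a Aa); have gf2 := gnfin _ _ _ (M2P a Aa).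
  rewrite !mixture_fin ?gp_fin// -EFinB; congr EFin.
  move: (fE a Aa) (hE a Aa); rewrite !payoff_diracl//.
  rewrite -(fineK (gp_fin piB Aa)) -(fineK (gp_fin piB' Aa)) -(fineK gf1) -(fineK gf2).
  rewrite -!EFinB => -[e1] -[e2] /=.
  move: e1 e2; set p1 := fine _; set n1 := fine _; set p2 := fine _; set n2 := fine _.
  move=> e1 e2; rewrite (_ : _ - _ = t * (p1 - n1) + (1 - t) * (p2 - n2))%R; last by ring.
  by rewrite e1 e2; ring.
Qed.

Let finite_payoffs_dirac a : Ax a -> finite_payoffs \d_(a : borelType TA).
Proof.
move=> Aa; split; first by rewrite /concentrated/= diracE mem_set.
move=> b Bb; rewrite (integral_dirac _ mbA); last first.
  by apply/measurable_EFinP; exact: measurable_fun_left.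
by rewrite /= diracE mem_set// mul1e.
Qed.

Let mixture_left (t : R) (mu nu rho : probability (borelType TA) R)
    (f : TA -> TB -> R) b : (0 <= t <= 1)%R -> is_mixture t mu nu rho ->
  jointly_measurable f -> (forall a b, (0 <= f a b)%R) -> Bx b ->
  \int[rho]_(a in Ax) (f a b)%:E = t%:E * \int[mu]_(a in Ax) (f a b)%:E +
    (1 - t)%:E * \int[nu]_(a in Ax) (f a b)%:E.
Proof.
move=> t01 mix mf f0 Bb; apply: integral_mixture => //.
- by apply/measurable_EFinP; exact: measurable_fun_left.
- by move=> a _; rewrite lee_fin.
Qed.

Lemma payoff_finite_minimax (bs : seq TB) (l : R) : Ax !=set0 ->
  (forall b, b \in bs -> Bx b) ->
  (forall piA, concentrated R Ax piA ->
    exists2 b, b \in bs & l%:E <= payoff Ax Bx g piA \d_(b : borelType TB)) ->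
  exists2 piB, safe Ax Bx g piB & l%:E <= payoff_flat Ax Bx g piB.
Proof.
move=> [a0 Aa0] bsB Hbs.
(* Outside [finite_payoffs], [fine] turns an infinite integral into 0; only values on
   [finite_payoffs] are used. *)
pose phi b (pi : probability (borelType TA) R) :=
  (fine (\int[pi]_(a in Ax) (gp a b)%:E) - fine (\int[pi]_(a in Ax) (gn a b)%:E) - l)%R.
have [|t s s' t01 [As Ss] [As' Ss']|b bbs|s [As Ss]|h [[piB [piBx [M MP] hE]] _] h0] :=
    @finite_minimax R _ (realized l) (@realized_convex l) _ phi bs finite_payoffs.
- by exists \d_(a0 : borelType TA); exact: finite_payoffs_dirac.
- have [rho rhoE] := mixture_exists s s' t01.
  have mix : is_mixture t s s' rho by move=> A _; exact: rhoE.
  exists rho; last by move=> f [_]; apply.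
  split; first by rewrite /concentrated/= rhoE As As' !mule1 -EFinD; congr EFin; ring.
  move=> b Bb; rewrite (mixture_left t01 mix)//.
  by rewrite mixture_fin ?Ss ?Ss'.
- have Bb := bsB b bbs; split; last first.
    move=> t mu nu rho t01 [_ Smu] [_ Snu] mix; rewrite /phi.
    rewrite !(mixture_left t01 mix)// !mixture_fin ?Smu ?Snu ?gn_fin//=; ring.
  exists \d_(b : borelType TB); split.
  + by rewrite /concentrated/= diracE mem_set.
  + have [_ /(_ b Bb)[m hm] _] := game; exists (Num.max (- m)%R 0%R) => a Aa.
    rewrite inner_dirac// lee_fin ge_max le_max; apply/andP; split; last first.
      by rewrite le_max lexx orbT.
    by rewrite lerN2 hm//; exists a.
  + move=> a Aa; rewrite payoff_dirac// /phi.
    have H (f : TA -> TB -> R) : jointly_measurable f ->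
        \int[\d_(a : borelType TA)]_(a' in Ax) (f a' b)%:E = (f a b)%:E.
      move=> mf; rewrite (integral_dirac _ mbA); last first.
        by apply/measurable_EFinP; exact: measurable_fun_left.
      by rewrite /= diracE mem_set// mul1e.
    by rewrite !H//= subrK -gpn.
- have [b bbs le] := Hbs s As; exists b => //.
  have Bb := bsB b bbs.
  move: le; rewrite payoff_diracr// -(fineK (Ss b Bb)) -(fineK (gn_fin s Bb)) -EFinB lee_fin.
  by rewrite /phi subr_ge0.
exists piB.
  (* The uniform bound [M] on the inner integral of the negative part keeps the double integral
     finite for every [piA]. *)
  split => // piA piAx; right; rewrite payoff_negE fin_numN ge0_fin_numE; last first.
    by apply: integral_ge0 => a _; exact: inner_ge0.
  apply: (@le_lt_trans _ _ (\int[piA]_(a in Ax) (cst `|M|%:E a))); last first.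
    by rewrite integral_cst//= piAx mule1 ltry.
  apply: ge0_le_integral => //.
  - by move=> a _; exact: inner_ge0.
  - exact: measurable_integral_right.
  - move=> a Aa; apply: le_trans (MP a Aa) _; rewrite lee_fin; exact: ler_norm.
apply: le_ereal_inf_tmp => _ [a Aa <-]; rewrite hE// lee_fin lerDr.
by apply: h0; exact: finite_payoffs_dirac.
Qed.

End one_game.

(** * Families of games *)

Lemma hausdorff_pair (T U : topologicalType) : hausdorff_space T ->
  hausdorff_space U -> hausdorff_space (T * U)%type.
Proof.
move=> hT hU p q pq; apply: injective_projections.
  apply: hT => A B pA qB; have [||r [rA rB]] := pq (fst @^-1` A) (fst @^-1` B).
  - by exists (A, setT) => [|r []]//; split => //=; exact: filterT.
  - by exists (B, setT) => [|r []]//; split => //=; exact: filterT.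
  - by exists r.1.
apply: hU => A B pA qB; have [||r [rA rB]] := pq (snd @^-1` A) (snd @^-1` B).
- by exists (setT, A) => [|r []]//; split => //=; exact: filterT.
- by exists (setT, B) => [|r []]//; split => //=; exact: filterT.
- by exists r.2.
Qed.

Lemma compact_cvg_seq (T : topologicalType) (u : nat -> T) (p : T) :
  u @ \oo --> p -> compact (range u `|` [set p]).
Proof.
move=> up F PF Fu; have [clp|] := pselect (cluster F p); first by exists p; split => //; right.
move=> /existsNP[S] /existsNP[N] /not_implyP[FS] /not_implyP[Np SN].
have [n _ Hn] := up _ Np.
have : compact (u @` `I_n).
  by apply: finite_compact; apply: finite_image; exact: finite_II.
move=> /(_ F PF)[|q [[k kn <-] clq]]; last by exists (u k); split => //; left; exists k.
apply: filterS (filterI Fu FS) => _ [[[k _ <-]|->] St].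
  have [kn|nk] := ltnP k n; first by exists k.
  by exfalso; apply: SN; exists (u k); split => //; exact: Hn.
by exfalso; apply: SN; exists p; split => //; exact: nbhs_singleton.
Qed.

Lemma cvg_inv_ball (R : realType) (T : pseudoMetricType R) (u : nat -> T) (p : T) :
  (forall k, ball p k.+1%:R^-1 (u k)) -> u @ \oo --> p.
Proof.
move=> pu; apply/cvg_ballP => e e0; near=> k.
apply: le_ball (pu k); near: k.
have := near_infty_natSinv_lt (PosNum e0); apply: filterS => k /=; exact: ltW.
Unshelve. all: by end_near. Qed.

Section game_kernel.
Context {R : realType} {TX TA TB : completePseudoMetricType R}.
Variables (KA : set (TX * TA)) (KB : set (TX * TB)) (c : TX -> TA -> TB -> R).
Hypotheses (polX : polish TX) (polA : polish TA) (polB : polish TB).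
Hypothesis c_inf_compact : K_inf_compact KA KB c.
Local Open Scope ereal_scope.

(* The payoff as a function on the whole of [TA], [+oo] outside the section of
   [KA]. *)
Definition ext_payoff (q : TX * TB) (a : TA) : \bar R :=
  if `[< KA (q.1, a) >] then (c q.1 a q.2)%:E else +oo.

Lemma ext_payoffE q a : KA (q.1, a) -> ext_payoff q a = (c q.1 a q.2)%:E.
Proof. by move=> Ka; rewrite /ext_payoff asboolT. Qed.

Lemma ext_payoff_le q a (l : R) :
  ext_payoff q a <= l%:E <-> KA (q.1, a) /\ (c q.1 a q.2 <= l)%R.
Proof.
rewrite /ext_payoff; case: asboolP => [Ka|nKa]; rewrite ?lee_fin; first by split=> [|[]].
by split=> // -[].
Qed.

Let hXBA : hausdorff_space (TX * TB * TA)%type.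
Proof.
have [? _] := polX; have [? _] := polA; have [? _] := polB.
by apply: hausdorff_pair => //; exact: hausdorff_pair.
Qed.

Let levelset (C : set (TX * TB)) (l : R) : set (TX * TB * TA) :=
  [set z | C z.1 /\ ext_payoff z.1 z.2 <= l%:E].

Let levelset_compact (C : set (TX * TB)) (l : R) : C !=set0 -> compact C ->
  C `<=` KB -> compact (levelset C l).
Proof.
move=> C0 cC CK; have := @c_inf_compact C l C0 cC CK.
congr compact; apply/seteqP; split=> z /=.
  by move=> [Cz Kz cz]; split => //; apply/ext_payoff_le.
by move=> [Cz /ext_payoff_le[]].
Qed.

(** If the payoff were unbounded below over [C], the nested nonempty compact level sets at heights
    [- n] would share a point, at which the real number [c] lies below every [- n]. *)
Lemma ext_payoff_lbound (C : set (TX * TB)) : compact C -> C `<=` KB ->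
  exists2 m : R, (0 <= m)%R & forall q, C q -> forall a, - m%:E <= ext_payoff q a.
Proof.
move=> cC CK; have [C0|C0] := pselect (C !=set0); last first.
  by exists 0%R => // q Cq; exfalso; apply: C0; exists q.
apply: contrapT => H.
have Hn n : exists z, levelset C (- n%:R) z.
  apply: contrapT => Hn; apply: H; exists n%:R => // q Cq a.
  rewrite leNgt; apply/negP => /ltW; rewrite -EFinN => qa.
  by apply: Hn; exists (q, a).
have [|n _|n _|i j _ _|z [_ Hz]] := @compact_directed_bigcap _ nat setT (levelset C 0)
    (fun n => levelset C (- n%:R)) (levelset_compact C0 cC CK).
- by exists 0%N.
- by apply: compact_closed => //; exact: levelset_compact.
- have [z [Cz hz]] := Hn n; exists z; do 2 split => //.
  by apply: le_trans hz _; rewrite lee_fin oppr_le0.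
- exists (maxn i j) => // z [Cz hz]; do 2 split => //; apply: le_trans hz _;
    by rewrite lee_fin lerN2 ler_nat leq_max leqnn ?orbT.
have [_ /ext_payoff_le[_ _]] := Hz 0%N I.
have := archi_boundP (normr_ge0 (c z.1.1 z.2 z.1.2)).
set n := Num.bound _ => cn.
have [_ /ext_payoff_le[_]] := Hz n I.
have := ler_norm (- c z.1.1 z.2 z.1.2)%R; rewrite normrN; lra.
Qed.

Let cvg_pairs (q : nat -> TX * TB) (p : TX * TB) :
  (forall k, KB (q k) /\ ball p k.+1%:R^-1 (q k)) -> KB p ->
  let C := range q `|` [set p] in [/\ compact C, C `<=` KB & C !=set0].
Proof.
move=> qp Kp C; split.
- by apply: compact_cvg_seq; apply: cvg_inv_ball => k; have [] := qp k.
- by move=> _ [[k _ <-]|->] //; have [] := qp k.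
- by exists p; right.
Qed.

(** A failure at every radius gives pairs [q k] converging to [p] with payoffs below [- k], against
    the bound on the compact set formed by the [q k] and [p]. *)
Lemma ext_payoff_lbound_near p : KB p -> exists2 m : R, (0 <= m)%R &
  exists k, forall q, KB q -> ball p k.+1%:R^-1 q -> forall a, - m%:E <= ext_payoff q a.
Proof.
move=> Kp; apply: contrapT => H.
have /choice[q Hq] k : exists q, (KB q /\ ball p k.+1%:R^-1 q) /\
    exists a, ext_payoff q a < - k%:R%:E.
  apply: contrapT => Hk; apply: H; exists k%:R => //; exists k => q Kq pq a.
  by rewrite leNgt; apply/negP => qa; apply: Hk; exists q; split => //; exists a.
have [cC CK C0] := cvg_pairs (fun k => proj1 (Hq k)) Kp.
have [m m0 Hm] := ext_payoff_lbound cC CK.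
have := archi_boundP m0; set n := Num.bound _ => mn.
have [_ [a]] := Hq n; apply/negP; rewrite -leNgt.
apply: le_trans (Hm (q n) _ a); last by left; exists n.
by rewrite leeN2 lee_fin ltW.
Qed.

(* Joint lower semicontinuity, in the uniform form needed to get open sets of
   [TA] independent of the perturbed pair [q]. *)
Lemma ext_payoff_lsc p a (l : R) : KB p -> l%:E < ext_payoff p a ->
  exists k, forall q, KB q -> ball p k.+1%:R^-1 q ->
    forall a', ball a k.+1%:R^-1 a' -> l%:E < ext_payoff q a'.
Proof.
move=> Kp lp; apply: contrapT => H.
have /choice[z Hz] k : exists z : TX * TB * TA,
    [/\ KB z.1, ball p k.+1%:R^-1 z.1, ball a k.+1%:R^-1 z.2 & ext_payoff z.1 z.2 <= l%:E].
  apply: contrapT => Hk; apply: H; exists k => q Kq pq a' aa'.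
  by rewrite ltNge; apply/negP => qa; apply: Hk; exists (q, a').
have [|cC CK C0] := @cvg_pairs (fun k => (z k).1) p _ Kp.
  by move=> k; have [? ? _ _] := Hz k.
have cS := @levelset_compact _ l C0 cC CK.
have zpa : z @ \oo --> (p, a).
  by apply: cvg_inv_ball => k; have [_ ? ? _] := Hz k.
have := closed_cvg _ (compact_closed hXBA cS) _ _ zpa.
move=> /(_ _)[|_ /=]; last by rewrite leNgt lp.
by apply: nearW => k; have [_ _ _ ?] := Hz k; split => //; left; exists k.
Qed.

Lemma ext_payoff_superlevel_open p (l : R) : KB p -> open [set a | l%:E < ext_payoff p a].
Proof.
move=> Kp; rewrite openE => a /= /(ext_payoff_lsc Kp)[k Hk].
apply/nbhs_ballP; exists (k.+1%:R^-1)%R => [|a' aa']; first by rewrite /= invr_gt0 ltr0Sn.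
by apply: Hk => //; apply: ballxx; rewrite invr_gt0 ltr0Sn.
Qed.

Lemma ext_payoff_measurable p : KB p ->
  measurable_fun (setT : set (borelType TA)) (ext_payoff p).
Proof.
move=> Kp; apply: emeasurable_fun_superlevel => r; apply: borel_open.
exact: ext_payoff_superlevel_open.
Qed.

Lemma shifted_payoff_lsc (I : Type) (F : set_system I) (FF : Filter F)
    (q : I -> TX * TB) (p : TX * TB) (mu : I -> probability (borelType TA) R)
    (pi : probability (borelType TA) R) (m r : R) : KB p -> q @ F --> p ->
  (\forall i \near F, KB (q i)) -> open_cvg F mu pi ->
  (forall a, - m%:E <= ext_payoff p a) ->
  (\forall i \near F, forall a, - m%:E <= ext_payoff (q i) a) ->
  r%:E < \int[pi]_a (ext_payoff p a + m%:E) ->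
  \forall i \near F, r%:E < \int[mu i]_a (ext_payoff (q i) a + m%:E).
Proof.
move=> Kp qp Kq mupi pm qm.
have shift_meas z : KB z -> measurable_fun (setT : set (borelType TA))
    (fun a => ext_payoff z a + m%:E).
  by move=> Kz; apply: emeasurable_funD => //; exact: ext_payoff_measurable.
have shift_ge0 z : (forall a, - m%:E <= ext_payoff z a) ->
    forall a, 0 <= ext_payoff z a + m%:E.
  by move=> zm a; rewrite -leeBlDr// sub0e.
have shift_level z (l : R) : [set a | l%:E < ext_payoff z a + m%:E] =
    [set a | (l - m)%:E < ext_payoff z a].
  by apply/seteqP; split=> a /=; rewrite EFinB lteBlDr.
apply: (integral_lsc (pi := pi)).
- exact: shift_meas.
- exact: shift_ge0.
- by move: Kq qm; apply: filterS2 => i Ki qi; split; [exact: shift_meas|exact: shift_ge0].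
move=> l s; rewrite shift_level; set k := (l - m)%R => lt.
(* Open sets on which the strict inequality holds for all pairs within [1 / n.+1] of [p]. By the
   uniform form of lower semicontinuity they increase to the superlevel set at [p], and once [q i]
   is that close they lie in the superlevel set at [q i]. *)
pose G n : set TA := [set a | forall z, KB z -> ball p n.+1%:R^-1 z -> k%:E < ext_payoff z a]°.
have GE : \bigcup_n G n = [set a | k%:E < ext_payoff p a].
  apply/seteqP; split=> [a [n _ /interior_subset]|a /= pa].
    by apply => //; apply: ballxx; rewrite invr_gt0 ltr0Sn.
  have [n Hn] := ext_payoff_lsc Kp pa; exists n => //.
  apply/nbhs_ballP; exists (n.+1%:R^-1)%R => [|a' aa']; first by rewrite /= invr_gt0 ltr0Sn.
  by move=> z Kz pz; exact: Hn.
have Gmono : nondecreasing_seq G.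
  move=> i j ij; apply/subsetPset; apply: interiorS => a Ha z Kz pz.
  by apply: Ha => //; apply: le_ball pz; rewrite lef_pV2 ?posrE// ler_nat.
have mG n : measurable (G n : set (borelType TA)).
  by apply: borel_open; exact: open_interior.
have mGU : measurable (\bigcup_n G n : set (borelType TA)) by exact: bigcupT_measurable.
have := nondecreasing_cvg_mu (mu := pi) mG mGU Gmono; rewrite GE.
move=> /(_ _ (open_ereal_gt' lt))[n _ /(_ n (leqnn n))] /= Gn.
have {}Gn := mupi _ (open_interior _) _ Gn.
have qn : \forall i \near F, ball p n.+1%:R^-1 (q i).
  by apply: qp; apply: nbhsx_ballx; rewrite invr_gt0 ltr0Sn.
near=> i; rewrite shift_level -/k.
have Ki : KB (q i) by near: i.
apply: (@lt_le_trans _ _ (mu i (G n))); first by near: i.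
apply: le_measure; rewrite ?inE//.
  apply: superlevel_measurable; exact: ext_payoff_measurable.
move=> a /interior_subset; apply => //.
by near: i.
Unshelve. all: by end_near. Qed.

(** * Level sets of the payoff against a pure strategy *)

Hypotheses (bKA : borel KA) (bKB : borel KB).

Definition payoff_level (q : TX * TB) (l : R) (pi : probability (borelType TA) R) : Prop :=
  concentrated R (xsection KA q.1) pi /\
  payoff (xsection KA q.1) (xsection KB q.1) (c q.1) pi \d_(q.2 : borelType TB) <= l%:E.

(** One integral inequality over the whole of [TA] expresses both constraints: mass outside the
    section of [KA], where [ext_payoff] is [+oo], would make the integral infinite. *)
Lemma payoff_level_shift q (m l : R) pi :
  zero_sum_game (xsection KA q.1) (xsection KB q.1) (c q.1) ->
  KB q -> (0 <= m)%R -> (forall a, - m%:E <= ext_payoff q a) ->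
  payoff_level q l pi <-> \int[pi]_a (ext_payoff q a + m%:E) <= (l + m)%:E.
Proof.
move=> game Kq m0 qm.
set Ax := xsection KA q.1; set Bx := xsection KB q.1.
have bAx : borel Ax by exact: borel_xsection.
have bBx : borel Bx by exact: borel_xsection.
have mAx : measurable (Ax : set (borelType TA)) by exact: bAx.
have mh : measurable_fun (setT : set (borelType TA)) (fun a => ext_payoff q a + m%:E).
  by apply: emeasurable_funD => //; exact: ext_payoff_measurable.
have h0 a : 0 <= ext_payoff q a + m%:E by rewrite -leeBlDr// sub0e.
have key : concentrated R Ax pi -> \int[pi]_a (ext_payoff q a + m%:E) =
    payoff Ax Bx (c q.1) pi \d_(q.2 : borelType TB) + m%:E.
  move=> piAx; have n0 : pi (~` Ax) = 0 by rewrite probability_setC// piAx subee.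
  rewrite (ge0_negligible_integral (N := ~` Ax : set (borelType TA)))//; last first.
  - exact: measurableC.
  rewrite setTD setCK -payoff_shift//; last 2 first.
  - by apply/xsectionP; case: (q) Kq.
  - move=> a /xsectionP Ka; rewrite -lee_fin -ext_payoffE//; exact: qm.
  by apply: eq_integral => a /set_mem/xsectionP Ka; rewrite ext_payoffE.
split=> [[piAx le]|le]; first by rewrite key// EFinD leeD2r.
have piAx : concentrated R Ax pi.
  suff n0 : pi (~` Ax) = 0.
    by rewrite /concentrated/= -[Ax]setCK probability_setC ?n0 ?sube0//; exact: measurableC.
  apply: contrapT => /eqP n0.
  have : \int[pi]_(a in (~` Ax : set (borelType TA))) (cst +oo) a <= (l + m)%:E.
    apply: le_trans le.
    apply: (@le_trans _ _
      (\int[pi]_(a in (~` Ax : set (borelType TA))) (ext_payoff q a + m%:E))).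
      rewrite le_eqVlt; apply/orP; left; apply/eqP; apply: eq_integral => a /set_mem na.
      by rewrite /ext_payoff asboolF// => Ka; apply: na; apply/xsectionP.
    by apply: ge0_subset_integral => //; exact: measurableC.
  rewrite integral_cst//; last exact: measurableC.
  by rewrite gt0_mulye// lt0e n0 measure_ge0.
by split => //; move: le; rewrite key// EFinD leeD2rE.
Qed.

Variables (X : set TX) (A : set TA).
Hypotheses (bA : borel A) (KAsub : forall q, KA q -> A q.2).
Hypotheses (KBsub : forall q, KB q -> X q.1).
Hypothesis KB_neq0 : forall x, X x -> exists b, KB (x, b).
Hypothesis game : forall x, X x ->
  zero_sum_game (xsection KA x) (xsection KB x) (c x).
Hypothesis B_lsc : lsc_correspondence X (xsection KB).

Let bsection x : borel (xsection KA x). Proof. exact: borel_xsection. Qed.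

(** The lower bound [- m] holds on a neighbourhood of [p], so a single shift serves [p] and the
    nearby [q i], and [shifted_payoff_lsc] rules out a larger integral in the limit. *)
Lemma payoff_level_closed (I : Type) (F : set_system I) (PF : ProperFilter F)
    (q : I -> TX * TB) (p : TX * TB) (mu : I -> probability (borelType TA) R)
    (pi : probability (borelType TA) R) (l : R) : KB p -> q @ F --> p ->
  (\forall i \near F, KB (q i)) -> open_cvg F mu pi ->
  (\forall i \near F, payoff_level (q i) l (mu i)) -> payoff_level p l pi.
Proof.
move=> Kp qp Kq mupi lev; have [m m0 [k mk]] := ext_payoff_lbound_near Kp.
have k0 : (0 < k.+1%:R^-1 :> R)%R by rewrite invr_gt0 ltr0Sn.
have gm z : KB z -> zero_sum_game (xsection KA z.1) (xsection KB z.1) (c z.1).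
  by move=> Kz; apply: game; exact: KBsub.
have pm := mk p Kp (ballxx _ k0).
have qk : \forall i \near F, ball p k.+1%:R^-1 (q i) by apply: qp; exact: nbhsx_ballx.
apply/(payoff_level_shift _ _ (gm _ Kp) Kp m0 pm); rewrite leNgt; apply/negP => lt.
have qm : \forall i \near F, forall a, - m%:E <= ext_payoff (q i) a.
  by move: Kq qk; apply: filterS2 => i Ki qi; exact: mk.
have := shifted_payoff_lsc _ Kp qp Kq mupi pm qm lt => gt.
near F => i.
have Ki : KB (q i) by near: i.
have qi : forall a, - m%:E <= ext_payoff (q i) a by near: i.
have : payoff_level (q i) l (mu i) by near: i.
move=> /(payoff_level_shift _ _ (gm _ Ki) Ki m0 qi); rewrite leNgt => /negP; apply.
near: i; exact: gt.
Unshelve. all: by end_near. Qed.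

Definition value_level (x : TX) (l : R) (pi : probability (borelType TA) R) : Prop :=
  forall b, KB (x, b) -> payoff_level (x, b) l pi.

(* Lower semicontinuity of [B] lets each [b] be approached along the filter;
   the index set is enlarged by [TB] to make the choice of the approximants. *)
Lemma value_level_closed (I : Type) (F : set_system I) (PF : ProperFilter F)
    (z : I -> TX) (x : TX) (mu : I -> probability (borelType TA) R)
    (pi : probability (borelType TA) R) (l : R) : X x -> z @ F --> x ->
  (\forall i \near F, X (z i)) -> open_cvg F mu pi ->
  (\forall i \near F, value_level (z i) l (mu i)) -> value_level x l pi.
Proof.
move=> Xx zx Xz mupi lev b Kb.
pose F' (S : set (I * TB)) := exists k, \forall i \near F, forall b',
  KB (z i, b') -> ball b k.+1%:R^-1 b' -> S (i, b').
have F'S (S : set (I * TB)) : (\forall i \near F, forall b', KB (z i, b') -> S (i, b')) -> F' S.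
  by move=> FS; exists 0%N; move: FS; apply: filterS => i H b' Kb' _; exact: H.
have F'1 (S : set I) : F S -> F' (fst @^-1` S).
  by move=> FS; apply: F'S; move: FS; apply: filterS.
have PF' : ProperFilter F'.
  split; last first.
    split.
    - by apply: F'S; exact: nearW.
    - move=> P Q [j Pj] [k Qk]; exists (maxn j k); move: Pj Qk; apply: filterS2.
      move=> i Pi Qi b' Kb' bb'; split; [apply: Pi|apply: Qi] => //;
        apply: le_ball bb'; by rewrite lef_pV2 ?posrE// ler_nat ltnS ?leq_maxl ?leq_maxr.
    - move=> P Q PQ [k Pk]; exists k; move: Pk; apply: filterS => i Pi b' Kb' bb'.
      by apply: PQ; exact: Pi.
  (* Properness of [F'] is where lower semicontinuity of [B] enters: near [x], the set [B (z i)]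
     meets every ball around [b]. *)
  move=> [k Fk].
  have bk : nbhs b (ball b (k.+1%:R^-1 : R)) by apply: nbhsx_ballx; rewrite invr_gt0 ltr0Sn.
  have W : xsection KB x `&` (ball b (k.+1%:R^-1 : R))° !=set0.
    by exists b; split; [exact/xsectionP|exact: bk].
  have {}W := B_lsc Xx (open_interior (ball b (k.+1%:R^-1 : R))) W.
  have Fz : \forall i \near F, exists b', KB (z i, b') /\ ball b k.+1%:R^-1 b'.
    have Fz0 : \forall i \near F, X (z i) ->
        xsection KB (z i) `&` (ball b (k.+1%:R^-1 : R))° !=set0 := zx _ W.
    move: Fz0 Xz; apply: filterS2 => i H /H.
    by move=> [b' [/xsectionP Kb' /interior_subset bb']]; exists b'.
  near F => i.
  have [b' [Kb' bb']] : exists b', KB (z i, b') /\ ball b k.+1%:R^-1 b' by near: i.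
  have H : forall b', KB (z i, b') -> ball b k.+1%:R^-1 b' -> set0 (i, b') by near: i.
  exact: (H b').
apply: (@payoff_level_closed _ F' PF' (fun ib => (z ib.1, ib.2)) _ (fun ib => mu ib.1)) => //.
- apply: cvg_pair; first by move=> N Nx; exact: (F'1 (z @^-1` N) (zx N Nx)).
  move=> N /nbhs_ballP[e /= e0 eN].
  have [k] := ltr_add_invr e0; rewrite add0r => ke.
  exists k; apply: nearW => i b' _ bb'; apply: eN => /=; apply: le_ball bb'; exact: ltW.
- by apply: F'S; exact: nearW.
- by move=> G oG r rG; exact: (F'1 [set i | r%:E < mu i G] (mupi G oG r rG)).
- by apply: F'S; move: lev; apply: filterS => i H b' Kb'; exact: H.
Unshelve. all: by end_near. Qed.

(** Markov's inequality outside the projection to [TA] of the compact level set at height [M]; this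
    projection does not depend on the pair in [C]. *)
Lemma payoff_level_tight (C : set (TX * TB)) (l e : R) : (0 < e)%R -> C !=set0 ->
  compact C -> C `<=` KB -> exists2 K : set TA, compact K & forall q pi, C q ->
    payoff_level q l pi -> (1 - e)%:E <= pi K.
Proof.
move=> e0 C0 cC CK; have [m m0 Cm] := ext_payoff_lbound cC CK.
(* Chosen so that mass larger than [e] outside [K] would give an integral above [M * e], which
   exceeds [l + m]. *)
pose M := ((`|l| + m + 1) / e)%R.
have M0 : (0 <= M)%R by rewrite divr_ge0 ?addr_ge0// ltW.
pose K := snd @` levelset C M.
have cK : compact K.
  apply: continuous_compact; last exact: levelset_compact.
  by apply: continuous_subspaceT => z; exact: cvg_snd.
have mK : measurable (K : set (borelType TA)).
  by apply: borel_closed; apply: compact_closed cK; case: polA.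
exists K => // q pi Cq; have Kq := CK _ Cq; have qm := Cm _ Cq.
move=> /(payoff_level_shift _ _ (game (KBsub Kq)) Kq m0 qm) le.
have mh : measurable_fun (setT : set (borelType TA)) (fun a => ext_payoff q a + m%:E).
  by apply: emeasurable_funD => //; exact: ext_payoff_measurable.
have h0 a : 0 <= ext_payoff q a + m%:E by rewrite -leeBlDr// sub0e.
have : \int[pi]_(a in (~` K : set (borelType TA))) (cst (M + m)%:E) a <= (l + m)%:E.
  apply: le_trans le.
  apply: (@le_trans _ _ (\int[pi]_(a in (~` K : set (borelType TA))) (ext_payoff q a + m%:E))).
    apply: ge0_le_integral => //.
    - exact: measurableC.
    - by move=> a _; rewrite lee_fin addr_ge0.
    - exact: measurable_funTS.
    - move=> a nKa; rewrite EFinD leeD2r// leNgt; apply/negP => /ltW lM.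
      by apply: nKa; exists (q, a).
  by apply: ge0_subset_integral => //; exact: measurableC.
rewrite integral_cst//; last exact: measurableC.
have nKE : pi (~` K) = 1 - pi K by rewrite probability_setC.
have piKfin : pi K \is a fin_num by rewrite fin_num_measure.
rewrite -[X in _ * X]/(pi (~` K)) nKE -(fineK piKfin) -EFinB -EFinM !lee_fin => H.
have Me : (M * e = `|l| + m + 1)%R by rewrite /M divfK// gt_eqF.
have me : (0 <= m * e)%R by rewrite mulr_ge0// ltW.
move: H; set k := fine _ => H; rewrite leNgt; apply/negP => ke.
have : ((M + m) * e < (M + m) * (1 - k))%R.
  rewrite ltr_pM2l; first by rewrite ltrBrDr addrC -ltrBrDr.
  by rewrite ltr_wpDr// divr_gt0// ltr_wpDl ?addr_ge0.
by move: (ler_norm l); rewrite mulrDl Me; lra.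
Qed.

Lemma payoff_level_weakP (pi : probability (borelType TA) R) q l :
  payoff_level q l pi -> exists pi' : weakP R A, weakP_val pi' = pi.
Proof.
move=> [piq _]; have piA : concentrated R A pi.
  apply: (concentratedS (bsection q.1) bA _ piq).
  by move=> a /xsectionP /KAsub.
by exists (SigSub (mem_set piA)).
Qed.

(** Prokhorov's theorem gives a limit on [TA]; closedness of the levels then shows that it is
    concentrated on the section over [p.1], hence on [A], which makes it a point of [weakP R A]. *)
Lemma payoff_level_cluster (I : Type) (U : set_system I) (UU : UltraFilter U)
    (q : I -> TX * TB) (p : TX * TB) (C : set (TX * TB)) (l : R)
    (mu : I -> weakP R A) : KB p -> q @ U --> p -> compact C -> C `<=` KB ->
  (\forall i \near U, C (q i)) ->
  (\forall i \near U, payoff_level (q i) l (weakP_val (mu i))) ->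
  exists pi : weakP R A, [/\ mu @ U --> pi,
    open_cvg U (fun i => weakP_val (mu i)) (weakP_val pi) &
    payoff_level p l (weakP_val pi)].
Proof.
move=> Kp qp cC CK UC lev.
have C0 : C !=set0 by have [i] := filter_ex UC; exists (q i).
have [|pi mupi] := @prokhorov _ _ _ U (fun i => weakP_val (mu i)) _ (proj1 polA).
  move=> e e0; have [K cK HK] := payoff_level_tight l e0 C0 cC CK.
  by exists K => //; move: UC lev; apply: filterS2 => i Ci; exact: HK.
have plev : payoff_level p l pi.
  apply: payoff_level_closed lev => //.
  by move: UC; apply: filterS => i; exact: CK.
have [pi' pi'E] := payoff_level_weakP plev.
by exists pi'; rewrite pi'E; split => //; apply: open_cvg_weakP => //; rewrite pi'E.
Qed.

Lemma payoff_level_compact p l : KB p ->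
  compact [set pi : weakP R A | payoff_level p l (weakP_val pi)].
Proof.
move=> Kp; rewrite compact_ultra => U UU Ulev.
have [|||||pi [Upi _ plev]] := @payoff_level_cluster _ U UU (fun=> p) p [set p] l id Kp.
- exact: cvg_cst.
- exact: compact_set1.
- by move=> _ ->.
- exact: nearW.
- exact: Ulev.
by exists pi.
Qed.

Lemma payoff_level_weakP_closed p l : KB p ->
  closed [set pi : weakP R A | payoff_level p l (weakP_val pi)].
Proof.
move=> Kp pi clpi; set S := [set pi | _] in clpi.
have PF : ProperFilter (within S (nbhs pi)) by exact: within_nbhs_proper.
have Fpi : (id : weakP R A -> weakP R A) @ (within S (nbhs pi)) --> pi by exact: cvg_within.
apply: (@payoff_level_closed _ _ PF (fun=> p) p (fun nu => weakP_val nu)) => //.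
- exact: cvg_cst.
- exact: nearW.
- exact: weakP_open_cvg Fpi.
- exact: withinT.
Qed.

(** * Level sets of the guaranteed payoff and the value *)

Definition value_set x l := [set pi : weakP R A | value_level x l (weakP_val pi)].

Lemma value_setE x l : value_set x l =
  \bigcap_(b in [set b | KB (x, b)]) [set pi | payoff_level (x, b) l (weakP_val pi)].
Proof. by []. Qed.

Lemma value_set_closed x l : closed (value_set x l).
Proof. by rewrite value_setE; apply: closed_bigI => b /= Kb; exact: payoff_level_weakP_closed. Qed.

Lemma value_set_compact x l : X x -> compact (value_set x l).
Proof.
move=> Xx; have [b0 Kb0] := KB_neq0 Xx.
rewrite (_ : value_set x l =
  [set pi | payoff_level (x, b0) l (weakP_val pi)] `&` value_set x l).
  by apply: compact_closedI; [exact: payoff_level_compact|exact: value_set_closed].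
by apply/seteqP; split=> pi; [move=> H; split => //; exact: H|case].
Qed.

Lemma value_set_mono x (l l' : R) : (l <= l')%R -> value_set x l `<=` value_set x l'.
Proof. by move=> ll' pi H b /H[? le]; split => //; apply: le_trans le _; rewrite lee_fin. Qed.

Lemma value_set_right x (l : R) pi : (forall r, (l < r)%R -> value_set x r pi) -> value_set x l pi.
Proof.
move=> H b Kb; have l1 : (l < l + 1)%R by rewrite ltrDl.
split; first by have [] := H _ l1 b Kb.
apply/lee_addgt0Pr => e e0; rewrite -EFinD.
have le : (l < l + e)%R by rewrite ltrDl.
by have [] := H _ le b Kb.
Qed.

(** Points approaching [x] are taken along a sequence, with partners [b] tending to [b0] by lower
    semicontinuity of [B]. The pairs then stay in a compact set, so their measures have a limit;
    [value_level_closed] extends the bound from [b0] to all [b]. *)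
Lemma value_domain_closed (D : set (weakP R A)) l : closed D ->
  closed [set x : X | value_set (set_val x) l `&` D !=set0].
Proof.
move=> clD x clx; set E := [set x | _] in clx.
have Xx : X (set_val x) by exact: set_valP.
have [b0 Kb0] := KB_neq0 Xx.
have k0 k : (0 < k.+1%:R^-1 :> R)%R by rewrite invr_gt0 ltr0Sn.
have /choice[w Hw] k : exists w : TX * TB * weakP R A,
    [/\ KB w.1, ball (set_val x, b0) (k.+1%:R^-1)%R w.1, value_set w.1.1 l w.2 & D w.2].
  have W : xsection KB (set_val x) `&` (ball b0 (k.+1%:R^-1 : R))° !=set0.
    by exists b0; split; [exact/xsectionP|exact: nbhsx_ballx].
  have {}W := B_lsc Xx (open_interior _) W.
  have bx : nbhs (set_val x) (ball (set_val x) (k.+1%:R^-1 : R)) by exact: nbhsx_ballx.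
  have [y [[pi [piy Dpi]] [xy /(_ (set_valP y))[b [/xsectionP Kb /interior_subset bb]]]]] :=
    clx _ (initial_continuous (filterI bx W)).
  by exists ((set_val y, b), pi).
have wx : (fun k => (w k).1) @ \oo --> (set_val x, b0).
  by apply: cvg_inv_ball => k; have [] := Hw k.
have [U [UU ooU]] := ultraFilterLemma eventually_filter.
have Uwx : (fun k => (w k).1) @ U --> (set_val x, b0) by move=> N /wx /ooU.
have [|||||pi [Upi mupi plev]] := @payoff_level_cluster _ U UU (fun k => (w k).1)
    (set_val x, b0) (range (fun k => (w k).1) `|` [set (set_val x, b0)]) l (fun k => (w k).2) Kb0.
- exact: Uwx.
- exact: compact_cvg_seq.
- by move=> _ [[k _ <-]|->] //; have [] := Hw k.
- by apply: nearW => k; left; exists k.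
- apply: nearW => k; have [Kw _ vw _] := Hw k.
  by have := vw (w k).1.2; rewrite -surjective_pairing; apply.
exists pi; split; last first.
  by apply: (closed_cvg _ clD _ _ Upi); apply: nearW => k; have [] := Hw k.
apply: (@value_level_closed _ U _ (fun k => (w k).1.1) _ _ _ _ Xx _ _ mupi).
- exact: cvg_comp Uwx (@cvg_fst _ _ _ _ _).
- by apply: nearW => k; have [/KBsub] := Hw k.
- by apply: nearW => k; have [] := Hw k.
Qed.

Hypothesis KA_neq0 : forall x, X x -> exists a, KA (x, a).

(** The value is the infimum of the guaranteed levels. A fixed [b0] bounds them below, a pure
    strategy [a] shows that one exists, and compactness of the nested level sets gives
    attainment. *)
Lemma game_value x : X x -> exists v : R, value_set x v !=set0 /\
  forall l, (l < v)%R -> value_set x l = set0.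
Proof.
move=> Xx; have [b0 Kb0] := KB_neq0 Xx.
pose S := [set l | value_set x l !=set0].
have [m m0 Hm] : exists2 m : R, (0 <= m)%R & forall a, - m%:E <= ext_payoff (x, b0) a.
  have [m m0 [k Hm]] := ext_payoff_lbound_near Kb0; exists m => //; apply: Hm => //.
  by apply: ballxx; rewrite invr_gt0 ltr0Sn.
have lbS : lbound S (- m)%R.
  move=> l [pi vpi]; have := vpi _ Kb0.
  move=> /(@payoff_level_shift (x, b0) m l _ (game Xx) Kb0 m0 Hm) le.
  suff : 0 <= (l + m)%:E by rewrite lee_fin -lerBlDr sub0r.
  apply: le_trans le; apply: integral_ge0 => a _.
  by rewrite -leeBlDr// sub0e.
have S0 : S !=set0.
  have [a Ka] := KA_neq0 Xx.
  have [_ _ /(_ a)[|u uP]] := game Xx; first exact/xsectionP.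
  have aA : concentrated R A \d_(a : borelType TA).
    by rewrite /concentrated/= diracE mem_set//; exact: (KAsub Ka).
  exists u, (SigSub (mem_set aA)) => b Kb.
  split; first by rewrite /concentrated/= diracE mem_set//; exact/xsectionP.
  have bKAx : borel (xsection KA x) by exact: borel_xsection.
  have bKBx : borel (xsection KB x) by exact: borel_xsection.
  have /= -> := payoff_dirac polA polB bKAx bKBx (game Xx)
    (iffRL (xsectionP _ _ _) Ka) (iffRL (xsectionP _ _ _) Kb).
  by rewrite lee_fin uP//; exists b => //; exact/xsectionP.
have hS : has_inf S by split => //; exists (- m)%R.
exists (inf S); split; last first.
  move=> l lS; apply: contrapT => /eqP/set0P Sl; move: lS; apply/negP; rewrite -leNgt.
  by apply: ge_inf => //; exists (- m)%R.
have below (r : R) : (inf S < r)%R -> value_set x r !=set0.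
  move=> Sr; have [l [pi vpi] lr] := inf_lt S0 Sr.
  by exists pi; apply: value_set_mono vpi; exact: ltW.
have [|||||pi [_ Hpi]] := @compact_directed_bigcap _ R [set r | (inf S < r)%R]
   (value_set x (inf S + 1)) (fun r => value_set x r).
- exact: value_set_compact.
- by exists (inf S + 1)%R; rewrite /= ltrDl.
- by move=> r _; exact: value_set_closed.
- move=> r /= Sr; have [|pi vpi] := below (Num.min r (inf S + 1))%R.
    by rewrite lt_min Sr ltrDl ltr01.
  by exists pi; split; apply: value_set_mono vpi; rewrite ge_min lexx ?orbT.
- move=> r s /= Sr Ss; exists (Num.min r s); first by rewrite /= lt_min Sr.
  by move=> pi vpi; split; apply: value_set_mono vpi; rewrite ge_min lexx ?orbT.
exists pi; apply: value_set_right => r Sr; exact: Hpi.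
Qed.

Lemma value_levelE x l pi : X x -> value_level x l pi <->
  concentrated R (xsection KA x) pi /\
  payoff_sharp (xsection KA x) (xsection KB x) (c x) pi <= l%:E.
Proof.
move=> Xx; split=> [H|[piAx le] b Kb].
  have [b0 Kb0] := KB_neq0 Xx; split; first by have [] := H b0 Kb0.
  by apply: ge_ereal_sup => _ [b /xsectionP Kb <-]; have [_] := H b Kb.
split=> //; apply: le_trans le; apply: ereal_sup_ubound; exists b => //.
exact/xsectionP.
Qed.

Lemma value_level_weakP x l pi : X x -> value_level x l pi ->
  exists pi' : weakP R A, weakP_val pi' = pi.
Proof.
by move=> Xx H; have [b0 Kb0] := KB_neq0 Xx; exact: payoff_level_weakP (H b0 Kb0).
Qed.

(* If the level set is empty, compactness already makes finitely many pure
   strategies [b] incompatible, and these carry a mixed strategy. *)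
Lemma minimax_lower x l : X x -> value_set x l = set0 ->
  exists2 piB, safe (xsection KA x) (xsection KB x) (c x) piB &
    l%:E <= payoff_flat (xsection KA x) (xsection KB x) (c x) piB.
Proof.
move=> Xx v0; have [b0 Kb0] := KB_neq0 Xx.
have bKAx : borel (xsection KA x) by exact: borel_xsection.
have bKBx : borel (xsection KB x) by exact: borel_xsection.
pose D := [set bs : seq TB | forall b, b \in bs -> KB (x, b)].
pose F (bs : seq TB) := [set pi : weakP R A | forall b, b \in bs ->
  payoff_level (x, b) l (weakP_val pi)].
pose K := [set pi : weakP R A | payoff_level (x, b0) l (weakP_val pi)].
have [bs [Dbs KF]] : exists bs, D bs /\ K `&` F bs = set0.
  apply: contrapT => H.
  have [||bs Dbs|bs Dbs|s t Ds Dt|pi [_ Hpi]] := @compact_directed_bigcap _ (seq TB) D K F.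
  - exact: payoff_level_compact.
  - by exists [::].
  - have -> : F bs = \bigcap_(b in [set b | b \in bs])
        [set pi | payoff_level (x, b) l (weakP_val pi)] by [].
    by apply: closed_bigI => b bbs; apply: payoff_level_weakP_closed; exact: Dbs.
  - by apply/set0P/eqP => E; apply: H; exists bs.
  - exists (s ++ t); first by move=> b; rewrite mem_cat => /orP[/Ds|/Dt].
    by move=> pi Hpi; split=> b bs; apply: Hpi; rewrite mem_cat bs ?orbT.
  have : value_set x l pi.
    by move=> b Kb; apply: (Hpi [:: b]); [move=> b'|]; rewrite inE => // /eqP ->.
  by rewrite v0.
(* Adding [b0] to the list puts any measure with payoff at most [l] against all listed strategies
   into [K]. *)
apply: (payoff_finite_minimax polA polB bKAx bKBx (game Xx) (bs := b0 :: bs)).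
- by have [a Ka] := KA_neq0 Xx; exists a; exact/xsectionP.
- by move=> b; rewrite inE => /orP[/eqP ->|/Dbs Kb]; exact/xsectionP.
move=> pi piAx; apply: contrapT => H.
have lev b : b \in b0 :: bs -> payoff_level (x, b) l pi.
  move=> bbs; split => //; rewrite leNgt; apply/negP => /ltW le; apply: H; exists b => //.
have [pi' pi'E] := payoff_level_weakP (lev b0 (mem_head _ _)).
have : (K `&` F bs) pi'.
  split; rewrite /K /F /= pi'E; first by apply: lev; exact: mem_head.
  by move=> b bbs; apply: lev; rewrite inE bbs orbT.
by rewrite KF.
Qed.

(** After the shift, each level is a sublevel set of an integral that is affine in the measure,
    which covers concentration as well as the bound. *)
Lemma value_set_convex x l : X x -> convex_weakP (value_set x l).
Proof.
move=> Xx t mu nu rho t01 Hmu Hnu mix b Kb.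
have [m m0 Hm] : exists2 m : R, (0 <= m)%R & forall a, - m%:E <= ext_payoff (x, b) a.
  have [m m0 [k Hm]] := ext_payoff_lbound_near Kb; exists m => //; apply: Hm => //.
  by apply: ballxx; rewrite invr_gt0 ltr0Sn.
have shift l' pi := @payoff_level_shift (x, b) m l' pi (game Xx) Kb m0 Hm.
have mix' (S : set (borelType TA)) : measurable S -> weakP_val rho S =
    t%:E * weakP_val mu S + (1 - t)%:E * weakP_val nu S by exact: mix.
apply/shift; rewrite (integral_mixture t01 mix')//; last 2 first.
- by apply: emeasurable_funD => //; exact: ext_payoff_measurable.
- by move=> a _; rewrite -leeBlDr// sub0e.
have /andP[t0 t1] := t01.
rewrite (_ : (l + m)%:E = t%:E * (l + m)%:E + (1 - t)%:E * (l + m)%:E); last first.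
  by rewrite -!EFinM -EFinD; congr EFin; ring.
apply: leeD; apply: lee_wpmul2l; rewrite ?lee_fin ?subr_ge0//.
  by apply/shift; exact: Hmu.
by apply/shift; exact: Hnu.
Qed.

Lemma value_level_graph_closed l :
  closed [set p : X * weakP R A | value_set (set_val p.1) l p.2].
Proof.
move=> p clp; set S := [set p | _] in clp.
have PF : ProperFilter (within S (nbhs p)) by exact: within_nbhs_proper.
have Fp : (id : X * weakP R A -> X * weakP R A) @ (within S (nbhs p)) --> p by exact: cvg_within.
apply: (@value_level_closed _ _ PF (fun p => set_val p.1) _ (fun p => weakP_val p.2)) => //.
- exact: set_valP.
- have F1 : (fun y : X * weakP R A => y.1) @ (within S (nbhs p)) --> p.1.
    move=> N Np; apply: Fp; exists (N, setT) => [|y []]//; split => //=.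
    exact: filterT.
  by apply: (cvg_comp _ _ F1); exact: initial_continuous.
- by apply: nearW => y; exact: set_valP.
- apply: (@weakP_open_cvg R TA A _ _ _ (fun p : X * weakP R A => p.2)) => //.
  move=> N Np; apply: Fp; exists (setT, N) => [|y []]//; split => //=.
  exact: filterT.
- exact: withinT.
Qed.

End game_kernel.

(** * Conclusion *)

(* The measures of the finite unions of basic open sets are lower
   semicontinuous and determine a measure on all open sets. *)
Lemma weakP_separating_sequence (R : realType) (T : completePseudoMetricType R)
    (E : set T) : polish T -> borel E -> exists u : nat -> weakP R E -> R,
  (forall k q, closed [set pi | u k pi <= q]) /\
  forall mu nu, (forall k, u k mu = u k nu) ->
    forall V : set (weakP R E), open V -> V mu -> V nu.
Proof.
move=> /polish_countable_base[W oW bW] bE.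
pose S (s : seq nat) : set T := \big[setU/set0]_(i <- s) W i.
have oS s : open (S s).
  rewrite /S; elim: s => [|i s IH]; first by rewrite big_nil; exact: open0.
  by rewrite big_cons; exact: openU.
pose U k := S (if @choice.unpickle (seq nat) k is Some s then s else [::]).
have fin_open (pi : probability (borelType T) R) (G : set T) : open G -> pi G \is a fin_num.
  by move=> oG; rewrite fin_num_measure//; exact: borel_open.
exists (fun k pi => fine (weakP_val pi (U k))); split.
  move=> k q; rewrite -[X in closed X]setCK; apply: open_closedC.
  rewrite openE => pi /= /negP; rewrite -ltNge => qpi.
  have piU : open_cvg (nbhs pi) (@weakP_val R T E) (weakP_val pi).
    exact: (@weakP_open_cvg R T E _ _ _ id).
  have UE (nu : weakP R E) : (q%:E < weakP_val nu (U k))%E = (q < fine (weakP_val nu (U k))).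
    by rewrite -lte_fin fineK// fin_open//; exact: oS.
  have := piU (U k) (oS _) q; rewrite UE => /(_ qpi); apply: filterS => nu /=.
  by rewrite UE => /lt_geF ->.
move=> mu nu munu; apply: weakP_indistinguishable => // G oG.
have munuS s : weakP_val mu (S s) = weakP_val nu (S s).
  have := munu (choice.pickle s); rewrite /U choice.pickleK => e.
  by rewrite -(fineK (fin_open (weakP_val mu) _ (oS s))) e fineK// fin_open.
pose G_ n := S [seq i <- iota 0 n | `[< W i `<=` G >]].
have GE : \bigcup_n G_ n = G.
  apply/seteqP; split=> x.
    move=> [n _]; rewrite /G_ /S -bigcup_seq => -[i /=].
    by rewrite mem_filter => /andP[/asboolP WG _]; exact: WG.
  move=> Gx; have [i [Wx WG]] := bW G x oG Gx; exists i.+1 => //.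
  have ii : i \in [seq i <- iota 0 i.+1 | `[< W i `<=` G >]].
    by rewrite mem_filter mem_iota add0n leq0n ltnSn !andbT; exact/asboolP.
  by rewrite /G_ /S -bigcup_seq; exists i.
have Gmono : nondecreasing_seq G_.
  move=> m n mn; apply/subsetPset; rewrite /G_ /S -!bigcup_seq => x [i /=].
  rewrite mem_filter mem_iota/= => /andP[WG im] Wx; exists i => //=.
  by rewrite mem_filter mem_iota/= WG (leq_trans im).
have cv (pi : probability (borelType T) R) : pi \o G_ @ \oo --> pi G.
  rewrite -[in pi G]GE; apply: nondecreasing_cvg_mu => //.
  - by move=> n; apply: borel_open; exact: oS.
  - by rewrite GE; exact: borel_open.
have := cv (weakP_val mu).
rewrite (_ : weakP_val mu \o G_ = weakP_val nu \o G_); last first.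
  by apply/funext => n /=; exact: munuS.
by move=> h; apply: (cvg_unique _ h (cv _)).
Qed.

Theorem theorem21 (R : realType) (TX TA TB : completePseudoMetricType R)
    (X : set TX) (A : set TA) (B : set TB)
    (KA : set (TX * TA)) (KB : set (TX * TB)) (c : TX -> TA -> TB -> R)
    (polX : polish TX) (polA : polish TA) (polB : polish TB)
    (bX : borel X) (bA : borel A) (bB : borel B)
    (bKA : borel KA) (KAsub : KA `<=` X `*` A)
    (bKB : borel KB) (KBsub : KB `<=` X `*` B)
    (KA_neq0 : forall x, X x -> xsection KA x !=set0)
    (KB_neq0 : forall x, X x -> xsection KB x !=set0)
    (game : forall x, X x ->
       zero_sum_game (xsection KA x) (xsection KB x) (c x))
    (c_inf_compact : K_inf_compact KA KB c)
    (B_lsc : lsc_correspondence X (xsection KB)) :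
  let Ax (x : X) := xsection KA (set_val x) in
  let Bx (x : X) := xsection KB (set_val x) in
  let cx (x : X) := c (set_val x) in
  exists v : X -> R,
    let Psharp (x : X) : set (weakP R A) :=
      sharp_level (Ax x) (Bx x) (cx x) (v x) in
    ((forall x : X,
        ereal_sup [set payoff_flat (Ax x) (Bx x) (cx x) piB
                  | piB in safe (Ax x) (Bx x) (cx x)] = (v x)%:E /\
        ereal_inf [set payoff_sharp (Ax x) (Bx x) (cx x) piA
                  | piA in concentrated R (Ax x)] = (v x)%:E) /\
     lower_semicontinuous (fun x : X => (v x)%:E)) /\
    [/\ (forall x : X,
           [/\ Psharp x !=set0, convex_weakP (Psharp x) &
               compact (Psharp x)]),
        borel [set p : X * weakP R A | Psharp p.1 p.2] &
        exists phi : X -> weakP R A,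
          borel_fun phi /\ forall x : X, Psharp x (phi x)].
Proof.
move=> Ax Bx cx.
have KAsub' q : KA q -> A q.2 by move=> /KAsub[].
have KBsub' q : KB q -> X q.1 by move=> /KBsub[].
have KA0 x : X x -> exists a, KA (x, a).
  by move=> /KA_neq0[a /xsectionP]; exists a.
have KB0 x : X x -> exists b, KB (x, b).
  by move=> /KB_neq0[b /xsectionP]; exists b.
have Xv (x : X) : X (set_val x) := set_valP x.
pose L (x : X) (l : R) : set (weakP R A) := @value_set R TX TA TB KA KB c A (set_val x) l.
have /choice[v vP] (x : X) : exists v : R, L x v !=set0 /\ forall l, l < v -> L x l = set0.
  exact: (game_value polX polA polB c_inf_compact bKA bKB bA KAsub' KBsub' KB0 game KA0 (Xv x)).
have vn0 x : L x (v x) !=set0 by have [] := vP x.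
have vlt x l : l < v x -> L x l = set0 by have [_] := vP x; apply.
have Lmono x (p q : R) : p <= q -> L x p `<=` L x q by move=> pq; exact: value_set_mono.
have Lcl x q : closed (L x q).
  exact: (value_set_closed polX polA polB c_inf_compact bKA bKB bA KBsub' game).
have Lco x q : compact (L x q).
  exact: (value_set_compact polX polA polB c_inf_compact bKA bKB bA KAsub' KBsub' KB0 game (Xv x)).
have Lr x q pi : (forall r, q < r -> L x r pi) -> L x q pi by exact: value_set_right.
have LD q D : closed D -> closed [set x : X | L x q `&` D !=set0].
  exact: (value_domain_closed polX polA polB c_inf_compact bKA bKB bA KAsub' KBsub' KB0 game B_lsc).
have levelE x l pi : value_level KA KB c (set_val x) l pi <->
    concentrated R (Ax x) pi /\ (payoff_sharp (Ax x) (Bx x) (cx x) pi <= l%:E)%E.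
  exact: (value_levelE KA c KB0 l pi (Xv x)).
exists v => Psharp.
have PsharpE x : Psharp x = L x (v x).
  by apply/seteqP; split=> pi; [move=> H; apply/levelE|move=> /levelE].
have bAx x : borel (Ax x) by exact: borel_xsection.
have bBx x : borel (Bx x) by exact: borel_xsection.
split; [split|split].
- move=> x; have gx := game _ (Xv x); split.
    apply/eqP; rewrite eq_le; apply/andP; split.
      have [pi /levelE[piAx piv]] := vn0 x.
      apply: ge_ereal_sup => _ [piB [piBx def] <-]; apply: le_trans piv.
      by apply: payoff_weak_duality => //; exact: def.
    (* At [v x - e] the level set is empty, so [minimax_lower] provides a safe strategy securing
       that amount. *)
    apply/lee_subgt0Pr => e e0; rewrite -EFinB.
    have ve : v x - e < v x by rewrite ltrBlDr ltrDl.
    have [piB sB leB] := minimax_lower polX polA polB c_inf_compact bKA bKB bA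
      KAsub' KBsub' KB0 game KA0 (Xv x) (vlt _ _ ve).
    by apply: le_trans leB _; apply: ereal_sup_ubound; exists piB.
  apply/eqP; rewrite eq_le; apply/andP; split.
    have [pi /levelE[piAx piv]] := vn0 x.
    by apply: le_trans piv; apply: ereal_inf_lbound; exists (weakP_val pi).
  (* A measure doing better than [v x] would belong to an empty level set. *)
  apply: le_ereal_inf_tmp => _ [pi piAx <-]; rewrite leNgt; apply/negP => lt.
  have [l lv lepi] : exists2 l, l < v x &
      (payoff_sharp (Ax x) (Bx x) (cx x) pi <= l%:E)%E.
    move: lt; case: payoff_sharp => [l| |]//; rewrite ?lte_fin => lv.
      by exists l.
    by exists (v x - 1); rewrite ?leNye// ltrBlDr ltrDl.
  have lev : value_level KA KB c (set_val x) l pi by apply/levelE.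
  have [pi' pi'E] := value_level_weakP bKA bA KAsub' KB0 (Xv x) lev.
  by have : L x l pi'; [rewrite /L /value_set/= pi'E|rewrite vlt].
- apply/lower_semicontinuousP => a.
  rewrite (_ : [set x | _] = ~` [set x : X | L x a `&` setT !=set0]).
    by apply: closed_openC; apply: LD; exact: closedT.
  apply/seteqP; split=> x /=; rewrite lte_fin; first by move=> /vlt -> [? []].
  move=> H; rewrite ltNge; apply/negP => va; apply: H.
  by have [pi Lpi] := vn0 x; exists pi; split => //; exact: Lmono Lpi.
- move=> x; rewrite PsharpE; split=> //.
  exact: (value_set_convex polX polA polB c_inf_compact bKA bKB game (Xv x)).
(* For rational [q] below [v] the level is empty and the first alternative holds; for the other [q]
   membership in the closed graph at level [q] is demanded, and these memberships pass to [v] by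
   [Lr]. *)
- rewrite (_ : [set p | _] = \bigcap_(q : rat)
      (~` [set p : X * weakP R A | L p.1 (ratr q) `&` setT !=set0] `|`
       [set p | L p.1 (ratr q) p.2])).
    apply: borel_bigcap => q; apply: borelU.
      apply: borelC; apply: (continuous_borel_fun _ (U := [set x | L x (ratr q) `&` setT !=set0])).
        by move=> p; exact: cvg_fst.
      by apply: borel_closed; apply: LD; exact: closedT.
    apply: borel_closed.
    exact: (value_level_graph_closed polX polA polB c_inf_compact bKA bKB bA KBsub' game B_lsc).
  apply/seteqP; split=> [p /=|p /= H].
    rewrite PsharpE => Lp q _; have [vq|qv] := leP (v p.1) (ratr q).
      by right; exact: Lmono Lp.
    by left; rewrite /= vlt// => -[? []].
  rewrite PsharpE; apply: Lr => r vr.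
  have [q] := rat_in_itvoo vr; rewrite in_itv/= => /andP[vq qr].
  apply: (Lmono _ _ _ (ltW qr)); have [/= []|//] := H q I.
  by have [pi Lpi] := vn0 p.1; exists pi; split => //; apply: Lmono Lpi; exact: ltW.
- have [u [clu usep]] := weakP_separating_sequence polA bA.
  have [f [bf fP]] := @compact_borel_selection R X (weakP R A) (fun x => L x (v x)) u
    (fun x => And3 (vn0 x) (Lcl x _) (Lco x _))
    (closed_measurable_level Lmono Lcl Lco Lr
       (fun q D clD => borel_closed (LD q D clD)) vn0 vlt) clu usep.
  by exists f; split => // x; rewrite PsharpE.
Qed.
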